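(* Let $\boldsymbol{L}=\{L_t\}_{t\ge 0}$ be a Gaussian Lévy process in a real, separable Banach space $B$, with drift $b\in B$, non-degenerate covariance $Q$, and zero Lévy measure, such that the law of $L_t$ has full support on $B$ for every $t>0$. Then the associated product system $E^{\boldsymbol{L}}$ is completely spatial.
   Context: Lévy process: a $B$-valued process $\boldsymbol{L}=\{L_t\}_{t\ge0}$ on $(\Omega,\mathcal{F},\mathbb{P})$ with $L_0=0$ a.s., stationary and independent increments, stochastic continuity, and a.s. càdlàg paths; $\mathcal{F}=\sigma\{L_t:t\ge0\}$, $\mathcal{F}_t=\sigma\{L_s:s\le t\}\vee\mathcal{N}$ and $\mathcal{F}_{s,t}=\sigma\{L_v-L_u:s\le u\le v\le t\}\vee\mathcal{N}$, with $\mathcal{N}$ the $\mathbb{P}$-null sets. Drift $b$, covariance $Q:B^*\times B^*\to\mathbb{R}$ and zero Lévy measure means $\mathbb{E}[e^{i\langle\phi,L_t\rangle}]=\exp\bigl(t(i\langle\phi,b\rangle-\tfrac12Q(\phi,\phi))\bigr)$ for $\phi\in B^*$. Non-degenerate means $Q(\phi,\phi)>0$ for $\phi\ne0$. Product system $E^{\boldsymbol{L}}$: the bundle $E^{\boldsymbol{L}}=\{(t,f): t>0,\ f\in L^2(\Omega,\mathcal{F}_t,\mathbb{P})\}\subset(0,\infty)\times L^2(\Omega,\mathcal{F},\mathbb{P})$ (complex $L^2$ spaces, Borel structure inherited from the product), with fibers $E(t)=L^2(\Omega,\mathcal{F}_t,\mathbb{P})$ and multiplication $U_{s,t}:E(s)\otimes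 E(t)\to E(s+t)$, $U_{s,t}(f\otimes g)=f\cdot S_{s,t}g$, written $fg$. Here $S_{s,t}:L^2(\Omega,\mathcal{F}_t,\mathbb{P})\to L^2(\Omega,\mathcal{F}_{s,s+t},\mathbb{P})$ is the unitary time shift, determined by sending $\tau(L_{t_1}-L_{t_0},\dots,L_{t_n}-L_{t_{n-1}})$ to $\tau(L_{t_1+s}-L_{t_0+s},\dots,L_{t_n+s}-L_{t_{n-1}+s})$ for $0=t_0\le\dots\le t_n=t$ and $\tau:B^n\to\mathbb{C}$ bounded measurable. A unit is a non-zero Borel section $t\mapsto u(t)\in E(t)$, $t>0$, with $u(s+t)=U_{s,t}(u(s)\otimes u(t))$ for all $s,t>0$. A product system is spatial if it has a unit. A spatial product system is completely spatial (type I) if, for every $t>0$, $E(t)$ is the closed linear span of finite products $u_1(t_1)u_2(t_2)\cdots u_k(t_k)$, where $u_1,\dots,u_k$ are units, $t_1,\dots,t_k>0$ and $t_1+\dots+t_k=t$. *)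

(* Defs.v *)
From HB Require Import structures.
From mathcomp Require Import all_boot all_order all_algebra.
From mathcomp Require Import complex.
From mathcomp Require Import all_classical all_reals all_analysis.
Set Implicit Arguments.
Unset Strict Implicit.
Unset Printing Implicit Defensive.
Import Order.TTheory GRing.Theory Num.Theory.
Import numFieldNormedType.Exports.
Import ComplexField.Normc.
Local Open Scope classical_set_scope.
Local Open Scope ring_scope.
Local Open Scope complex_scope.

HB.instance Definition _ (R : realType) := isPointed.Build R[i] (0 +i* 0).

Notation borel B := (g_sigma_algebraType (@open B)).

Definition separable_space (T : topologicalType) : Prop :=
  exists2 D : set T, countable D & dense D.

Section ComplexFunctions.
Context (R : realType).

Definition cexp (z : R[i]) : R[i] :=
  (expR (complex.Re z))%:C * (cos (complex.Im z) +i* sin (complex.Im z)).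

Definition cexpectation d (T : measurableType d) (P : probability T R)
    (f : T -> R[i]) : R[i] :=
  fine 'E_P[fun w => complex.Re (f w)] +i* fine 'E_P[fun w => complex.Im (f w)].

Definition cmeasurable d (T : measurableType d) (f : T -> R[i]) : Prop :=
  measurable_fun [set: T] (fun w => complex.Re (f w)) /\
  measurable_fun [set: T] (fun w => complex.Im (f w)).

Definition cbounded (T : Type) (f : T -> R[i]) : Prop :=
  exists M : R, forall x, normc (f x) <= M.

End ComplexFunctions.

Section Dual.
Context (R : realType) (B : completeNormedModType R).

Definition dual (phi : B -> R^o) : Prop := linear phi /\ continuous phi.

Definition covariance_form (Q : (B -> R^o) -> (B -> R^o) -> R) : Prop :=
  [/\ forall phi psi, dual phi -> dual psi -> Q phi psi = Q psi phi,
      forall (a : R) phi psi chi, dual phi -> dual psi -> dual chi ->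
        Q (a *: phi + psi) chi = a * Q phi chi + Q psi chi
    & forall phi, dual phi -> 0 <= Q phi phi].

Definition nondegenerate_covariance (Q : (B -> R^o) -> (B -> R^o) -> R) : Prop :=
  forall phi, dual phi -> phi <> cst 0 -> 0 < Q phi phi.

Definition cadlag (x : R -> B) : Prop :=
  (forall t : R, 0 <= t -> x y @[y --> t^'+] --> x t) /\
  (forall t : R, 0 < t -> cvg (x y @[y --> t^'-])).

End Dual.

(* Processes are indexed by R and only their values at times t >= 0 matter. *)
Section Levy.
Context (R : realType) (B : completeNormedModType R).
Context (d : measure_display) (Omega : measurableType d).
Context (P : probability Omega R).
Implicit Type L : R -> Omega -> B.

Definition increment L (s t : R) : Omega -> borel B :=
  fun w => L t w - L s w.

Definition independent n (X : 'I_n -> Omega -> borel B) : Prop :=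
  forall A : 'I_n -> set (borel B), (forall i, measurable (A i)) ->
    P [set w | forall i, A i (X i w)] = (\prod_(i < n) P (X i @^-1` A i))%E.

Record levy_process L : Prop := {
  levy_measurable : forall t : R, 0 <= t ->
    measurable_fun [set: Omega] (L t : Omega -> borel B) ;
  levy_start : \forall w \ae P, L 0 w = 0 ;
  levy_stationary : forall (s h : R) (A : set (borel B)),
    0 <= s -> 0 <= h -> measurable A ->
    P (increment L s (s + h) @^-1` A) = P (increment L 0 h @^-1` A) ;
  levy_independent : forall n (tt : nat -> R), 0 <= tt 0%N ->
    (forall i, (i < n)%N -> tt i <= tt i.+1) ->
    independent (fun i : 'I_n => increment L (tt i) (tt i.+1)) ;
  levy_stochastically_continuous : forall t e : R, 0 <= t -> 0 < e ->
    P [set w | e < `|L s w - L t w|]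
      @[s --> within [set s | 0 <= s] (nbhs t)] --> 0%E ;
  levy_cadlag : \forall w \ae P, cadlag (fun t => L t w)
}.

Definition process_sigma_algebra L : set (set Omega) :=
  <<s \bigcup_(t in [set t : R | 0 <= t])
        preimage_set_system setT (L t : Omega -> borel B) measurable >>.

(* Levy-Khintchine formula with drift b, covariance Q and zero Levy measure *)
Definition gaussian_without_jumps L (b : B) (Q : (B -> R^o) -> (B -> R^o) -> R)
    : Prop :=
  forall (phi : B -> R^o) (t : R), dual phi -> 0 <= t ->
    cexpectation P (fun w => cexp ('i%C * (phi (L t w) : R)%:C)) =
    cexp (t%:C * ('i%C * (phi b : R)%:C - (2^-1 * Q phi phi)%:C)).

Definition fully_supported L : Prop :=
  forall t : R, 0 < t -> forall U : set B, open U -> U !=set0 ->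
    (0 < P (L t @^-1` U))%E.

End Levy.

(* Elements of L^2 are handled through representatives Omega -> R[i]; equality
   in L^2 is equality almost everywhere. *)
Section ProductSystem.
Context (R : realType) (B : completeNormedModType R).
Context (d : measure_display) (Omega : measurableType d).
Context (P : probability Omega R) (L : R -> Omega -> B).
Local Notation C := R[i].

Definition null_sets : set (set Omega) := [set N | measurable N /\ P N = 0%E].

(* [past t] and [between s t] generate F_t and F_{s,t}. *)
Definition past (t : R) : set (set Omega) :=
  (\bigcup_(s in [set s : R | 0 <= s <= t])
    preimage_set_system setT (L s : Omega -> borel B) measurable)
  `|` null_sets.

Definition between (s t : R) : set (set Omega) :=
  (\bigcup_(p in [set p : R * R | [/\ s <= p.1, p.1 <= p.2 & p.2 <= t]])
    preimage_set_system setT (increment L p.1 p.2) measurable)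
  `|` null_sets.

Definition L2norm (f : Omega -> C) : \bar R :=
  'N[P]_2%:E[EFin \o (fun w => normc (f w))]%E.

(* L^2(Omega, <<s G >>, P) *)
Definition L2 (G : set (set Omega)) : set (Omega -> C) :=
  [set f | @cmeasurable R _ (g_sigma_algebraType G) f /\ (L2norm f < +oo)%E].

Definition fiber (t : R) : set (Omega -> C) := L2 (past t).

Definition L2_open : set (set (Omega -> C)) :=
  [set A | A `<=` L2 measurable /\
    forall f, A f -> exists2 e : R, 0 < e &
      forall g, L2 measurable g -> (L2norm (fun w => (f w - g w)%R) < e%:E)%E -> A g].

(* The Borel sets of L^2 as sets of representatives: members of [L2_open] are
   saturated for almost everywhere equality. *)
Definition L2_borel := g_sigma_algebraType L2_open.

Definition cylinder n (tt : nat -> R) (tau : n.-tuple (borel B) -> C) (s : R)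
    : Omega -> C :=
  fun w => tau [tuple increment L (tt i + s) (tt i.+1 + s) w | i < n].

Record is_time_shift (s t : R) (S : (Omega -> C) -> (Omega -> C)) : Prop := {
  shift_into : forall f, fiber t f -> L2 (between s (s + t)) (S f) ;
  shift_ae : forall f g, fiber t f -> fiber t g ->
    (\forall w \ae P, f w = g w) -> \forall w \ae P, S f w = S g w ;
  shift_linear : forall (a : C) f g, fiber t f -> fiber t g ->
    \forall w \ae P, S (fun w => a * f w + g w) w = a * S f w + S g w ;
  shift_isometry : forall f, fiber t f -> L2norm (S f) = L2norm f ;
  shift_onto : forall h, L2 (between s (s + t)) h ->
    exists2 f, fiber t f & \forall w \ae P, S f w = h w ;
  shift_cylinder : forall n (tt : nat -> R) (tau : n.-tuple (borel B) -> C),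
    tt 0%N = 0 -> tt n = t -> (forall i, (i < n)%N -> tt i <= tt i.+1) ->
    cmeasurable tau -> cbounded tau ->
    \forall w \ae P, S (cylinder tt tau 0) w = cylinder tt tau s w
}.

(* The time shift, unique up to almost everywhere equality. *)
Definition time_shift (s t : R) : (Omega -> C) -> (Omega -> C) :=
  @xget ((Omega -> C) -> (Omega -> C)) id [set S | is_time_shift s t S].

Definition mult (s t : R) (f g : Omega -> C) : Omega -> C :=
  fun w => f w * time_shift s t g w.

Record is_unit (u : R -> Omega -> C) : Prop := {
  unit_section : forall t : R, 0 < t -> fiber t (u t) ;
  unit_borel : measurable_fun (`]0, +oo[%classic : set R)
    (fun t : R => (t, u t) : (measurableTypeR R * L2_borel)%type) ;
  unit_nonzero : exists2 t : R, 0 < t & ~ (\forall w \ae P, u t w = 0) ;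
  unit_mult : forall s t : R, 0 < s -> 0 < t ->
    \forall w \ae P, u (s + t) w = mult s t (u s) (u t) w
}.

(* Products u_1(t_1) ... u_k(t_k), bracketed to the right, with
   t = t_1 + ... + t_k. *)
Inductive unit_product : R -> (Omega -> C) -> Prop :=
| unit_product1 u (t : R) : is_unit u -> 0 < t -> unit_product t (u t)
| unit_productS u (s t : R) g : is_unit u -> 0 < s -> unit_product t g ->
    unit_product (s + t) (mult s t (u s) g).

Definition closed_span (A : set (Omega -> C)) : set (Omega -> C) :=
  [set f | L2 measurable f /\
    forall e : R, 0 < e ->
      exists n (c : 'I_n -> C) (p : 'I_n -> Omega -> C),
        (forall i, A (p i)) /\
        (L2norm (fun w => (f w - \sum_(i < n) c i * p i w)%R) < e%:E)%E].

Definition spatial : Prop := exists u, is_unit u.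

Definition completely_spatial : Prop :=
  spatial /\ forall t : R, 0 < t -> fiber t = closed_span (unit_product t).

End ProductSystem.

(* Main.v *)
From HB Require Import structures.
From mathcomp Require Import all_boot all_order all_algebra.
From mathcomp Require Import complex.
From mathcomp Require Import ring lra.
From mathcomp Require Import all_classical all_reals all_analysis.
From mathcomp Require Import measurable_realfun.
Require Import Defs.
Set Implicit Arguments.
Unset Strict Implicit.
Unset Printing Implicit Defensive.
Import Order.TTheory GRing.Theory Num.Theory.
Import numFieldNormedType.Exports.
Import ComplexField.Normc.
Local Open Scope classical_set_scope.
Local Open Scope ring_scope.

(** Let [phi] be a continuous linear functional on [B]. Since [L (s + t)] is the
    sum of [L s] and of the time shift of [L t], the character [exp (i phi (L t))]
    satisfies the product rule of units; it is bounded, hence square-integrable,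
    and stochastic continuity makes it continuous in mean square, hence a Borel
    section ([character_unit_is_unit]). A product of such units along a partition
    of [[0, t]] is the exponential of [i] times a sum of functionals of increments,
    and every finite sum of functionals of values [L r] with [r <= t] is of this
    form ([observable_phase], [phase_unit_product]).

    The linear span of these exponentials is dense in the fibre over [t]. Bounded
    pointwise limits of linear combinations of the cosines and sines of all such
    sums form an algebra closed under absolute values, hence they contain the
    indicators of all events that the sums generate ([bclosure_characters_sigma]).
    By the Hahn-Banach theorem and separability, functionals generate the Borel
    sets of [B] ([measurable_fun_dual]); so up to null sets these events exhaust
    the past, and simple functions conclude ([fiber_closed_span]).

    For the converse inclusion, a product of units is square-integrable because
    its factors are independent ([fiber_mult]), and L2 limits stay measurable for
    the past because the past contains the null sets ([closed_span_fiber]).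

    Multiplication in the product system involves the time shift, whose existence
    has to be established first ([time_shift_exists]). A random variable of the
    past is a functional of the path, and shifting it means evaluating the
    functional on the shifted path. This is well defined and isometric because the
    path and the shifted path have the same law, which follows, together with the
    independence of past and future, from the independence and stationarity of
    increments by the pi-lambda theorem, in two steps
    ([shifted_path_indep]). *)

(** * Functionals separating a separable Banach space *)

Section HahnBanach.
Context (R : realType) (V : normedModType R).

(** Zorn's lemma runs over graphs: a set of pairs carries the domain of a
    partial functional along, and chains of graphs are glued by union. *)
Definition dominated_graph (G : set (V * R)) : Prop :=
  (forall a x r y s, G (x, r) -> G (y, s) -> G (a *: x + y, a * r + s)) /\
  (forall x r, G (x, r) -> r <= `|x|).

Lemma dominated_graph_uniq G x r s : dominated_graph G ->
  G (x, r) -> G (x, s) -> r = s.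
Proof.
move=> [linG domG] Gr Gs.
have key u v : G (x, u) -> G (x, v) -> v <= u.
  move=> Gu Gv; have := domG _ _ (linG (-1) _ _ _ _ Gu Gv).
  by rewrite scaleN1r addNr normr0 mulN1r addrC subr_le0.
by apply/eqP; rewrite eq_le !key.
Qed.

(** The values allowed at [x0] are at least [r - |x - x0|] and at most
    [|y + x0| - s], for all pairs [(x, r)] and [(y, s)] of the graph. The triangle
    inequality keeps these bounds in order, so the supremum of the lower ones is
    allowed. *)
Lemma dominated_graph_extend G x0 : dominated_graph G -> G !=set0 ->
  exists c : R, dominated_graph
    [set z | exists a x r, G (x, r) /\ z = (x + a *: x0, r + a * c)].
Proof.
move=> [linG domG] [[v0 r0] Gv0].
have G0 : G (0, 0).
  have := linG (-1) _ _ _ _ Gv0 Gv0.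
  by rewrite scaleN1r addNr mulN1r addNr.
have scG a x r : G (x, r) -> G (a *: x, a * r).
  by move=> Gx; have := linG a _ _ _ _ Gx G0; rewrite !addr0.
pose S := [set t | exists x r, G (x, r) /\ t = r - `|x - x0|].
have ubS y s : G (y, s) -> ubound S (`|y + x0| - s).
  move=> Gy t [x [r [Gx ->]]].
  have := domG _ _ (linG 1 _ _ _ _ Gx Gy); rewrite scale1r mul1r => h.
  have : `|x + y| <= `|x - x0| + `|y + x0|.
    by rewrite (_ : x + y = (x - x0) + (y + x0)) ?ler_normD // addrACA addNr addr0.
  by move: h; lra.
have S0 : S !=set0 by exists (0 - `|0 - x0|), 0, 0.
have hS : has_sup S by split => //; exists (`|0 + x0| - 0); exact: ubS.
exists (sup S).
have lo x r : G (x, r) -> r - `|x - x0| <= sup S.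
  by move=> Gx; apply: ub_le_sup; [exact: hS.2|exists x, r].
have hi y s : G (y, s) -> sup S <= `|y + x0| - s.
  by move=> Gy; apply: ge_sup => //; exact: ubS.
split.
  move=> a x r y s [a1 [x1 [r1 [G1 [-> ->]]]]] [a2 [x2 [r2 [G2 [-> ->]]]]].
  exists (a * a1 + a2), (a *: x1 + x2), (a * r1 + r2); split; first exact: linG.
  congr pair; last by ring.
  by rewrite scalerDr scalerA addrACA scalerDl.
move=> _ _ [a [x [r [Gx [-> ->]]]]].
have [a0|a0|->] := ltgtP a 0; last by rewrite mul0r scale0r !addr0; exact: domG.
- have na : 0 < - a by rewrite oppr_gt0.
  have := lo _ _ (scG ((- a)^-1) _ _ Gx).
  rewrite -(ler_pM2l na) mulrBr mulrA divff ?gt_eqF // mul1r.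
  rewrite -[X in _ - X * _](gtr0_norm na) -normrZ scalerBr scalerA divff ?gt_eqF //.
  by rewrite scale1r scaleNr opprK; lra.
- have := hi _ _ (scG (a^-1) _ _ Gx).
  rewrite -(ler_pM2l a0) mulrBr mulrA divff ?gt_eqF // mul1r.
  rewrite -[X in X * `|_|](gtr0_norm a0) -normrZ scalerDr scalerA divff ?gt_eqF //.
  by rewrite scale1r; lra.
Qed.

(** The functional [a v -> a |v|] on the line through [v] is extended maximally. *)
Lemma hahn_banach_norming (v : V) : exists phi : V -> R^o,
  [/\ linear phi, phi v = `|v| & forall x, `|phi x| <= `|x|].
Proof.
pose base : set (V * R) := [set z | exists a, z = (a *: v, a * `|v|)].
(* The empty graph is good because it is the union of the empty chain. *)
pose good G := dominated_graph G /\ (G !=set0 -> base `<=` G).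
have good_base : dominated_graph base.
  split.
    move=> a x r y s [b [-> ->]] [c [-> ->]]; exists (a * b + c).
    by rewrite scalerDl scalerA mulrDl mulrA.
  by move=> x r [a [-> ->]]; rewrite normrZ ler_wpM2r // ler_norm.
have [|A [[domA baseA] maxA]] := @Zorn_bigcup _ good.
  move=> F Fgood Ftot; split; last first.
    move=> [z [X FX Xz]] w bw; exists X => //.
    by apply: (Fgood _ FX).2 => //; exists z.
  split.
    move=> a x r y s [X FX Xx] [Y FY Yy].
    by have [XY|YX] := Ftot _ _ FX FY; [exists Y => //|exists X => //];
      [apply: (Fgood _ FY).1.1 => //; exact: XY|
       apply: (Fgood _ FX).1.1 => //; exact: YX].
  by move=> x r [X FX Xx]; exact: (Fgood _ FX).1.2 Xx.
have A0 : A !=set0.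
  apply: contrapT => nA; apply: (maxA base); last by split=> [|_].
  split; first by move=> z Az; exfalso; apply: nA; exists z.
  move=> bA; apply: nA; exists (0, 0); apply: bA; exists 0.
  by rewrite scale0r mul0r.
have {}baseA := baseA A0.
have A00 : A (0, 0) by apply: baseA; exists 0; rewrite scale0r mul0r.
have totA x : exists r, A (x, r).
  have [c domc] := dominated_graph_extend x domA A0.
  apply: contrapT => nx; apply: (maxA _ _ (conj domc _)).
    split; first by move=> [y s] Ay; exists 0, y, s; rewrite scale0r mul0r !addr0.
    move=> sub; apply: nx; exists c; apply: sub.
    by exists 1, 0, 0; rewrite scale1r mul1r !add0r.
  by move=> _ [y s] /baseA By; exists 0, y, s; rewrite scale0r mul0r !addr0.
have [phi Aphi] := choice totA.
exists phi; split.
- move=> a x y; apply: (dominated_graph_uniq domA (Aphi _)).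
  exact: domA.1.
- apply: (dominated_graph_uniq domA (Aphi _)); apply: baseA; exists 1.
  by rewrite scale1r mul1r.
- move=> x; rewrite ler_norml (domA.2 _ _ (Aphi x)) andbT.
  have := domA.1 (-1) _ _ _ _ (Aphi x) A00.
  by rewrite !addr0 scaleN1r mulN1r => /domA.2; rewrite normrN lerNl.
Qed.

End HahnBanach.

Section BorelDual.
Context (R : realType) (B : completeNormedModType R).
Hypothesis sepB : separable_space B.

Lemma dense_sequence : exists e : nat -> B,
  forall x (eps : R), 0 < eps -> exists n, `|x - e n| < eps.
Proof.
have [D /countable_injP[f injf] denD] := sepB.
exists (fun n => xget 0 [set x | D x /\ f x = n]) => x eps eps0.
have [y [By Dy]] : ball x eps `&` D !=set0.
  by apply: denD; [exists x; exact: ballxx|exact: ball_open].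
exists (f y); case: xgetP => [z _ [Dz fz]|/(_ y)]; last by case.
have zy : z = y by apply: injf => //; rewrite inE.
by move: By; rewrite -ball_normE zy.
Qed.

Lemma dual_bounded (phi : B -> R^o) : linear phi ->
  (forall x, `|phi x| <= `|x|) -> dual phi.
Proof.
move=> linphi bphi; split=> // x; apply/cvgrPdist_lt => e e0; near=> y.
have -> : phi x - phi y = phi (x - y).
  by have := linphi (-1) y x; rewrite !scaleN1r [- y + x]addrC => ->; rewrite addrC.
by apply: le_lt_trans (bphi _) _; near: y; apply: cvgr_dist_lt.
Unshelve. all: by end_near. Qed.

Lemma dualD (phi : B -> R^o) x y : dual phi -> phi (x + y) = phi x + phi y.
Proof. by move=> [l _]; have := l 1 x y; rewrite !scale1r. Qed.

Lemma dualB (phi : B -> R^o) x y : dual phi -> phi (x - y) = phi x - phi y.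
Proof.
move=> [l _]; have := l (-1) y x.
by rewrite !scaleN1r [- y + x]addrC => ->; rewrite addrC.
Qed.

Lemma dualZ (a : R) (phi : B -> R^o) : dual phi -> dual (fun x => a *: phi x).
Proof.
move=> [l c]; split.
  by move=> b x y; rewrite l scalerDr !scalerA mulrC.
by move=> x; apply: cvgZr; exact: c.
Qed.

Lemma measurable_dual_comp d (T : measurableType d) (f : T -> borel B)
    (phi : B -> R^o) : dual phi -> measurable_fun setT f ->
  measurable_fun setT (fun w => phi (f w) : R).
Proof.
move=> [_ cphi] mf.
apply: (measurability _ (RGenOpens.measurableE R)) => _ [_ [a [b ->] <-]].
have oU : open (`]a, b[%classic : set R) by exact: interval_open.
move: {a b} (`]a, b[%classic : set R) oU => U oU; rewrite setTI.
have := @mf measurableT (phi @^-1` U); rewrite setTI; apply.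
by apply: sub_sigma_algebra; exact: open_comp.
Qed.

(** Countably many functionals norm a separable space, so that its closed balls
    are countable intersections of half-spaces. *)
Lemma measurable_fun_dual d (T : measurableType d) (f : T -> borel B) :
  (forall phi : B -> R^o, dual phi ->
    measurable_fun setT (fun w => phi (f w) : R)) ->
  measurable_fun setT f.
Proof.
move=> mf; have [e dense_e] := dense_sequence.
have [phi phiP] := choice (fun n => hahn_banach_norming (e n)).
have dphi n : dual (phi n) by have [? _ ?] := phiP n; exact: dual_bounded.
have phiB n x y : phi n (x - y) = phi n x - phi n y by exact: dualB.
have normP x q : (forall n, phi n x <= q) -> `|x| <= q.
  move=> H; apply/ler_addgt0Pr => eps eps0.
  have [n xn] := dense_e x (eps / 2) (divr_gt0 eps0 (ltr0Sn R 1)).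
  have [l en bn] := phiP n.
  have h1 : `|x| <= `|x - e n| + `|e n| by rewrite -{1}(subrK (e n) x) ler_normD.
  have h2 := phiB n (e n) x; have := bn (e n - x); rewrite distrC => h3.
  have h4 := ler_norm (phi n (e n - x)); have := H n; move: h1 h2 h3 h4 en xn.
  by rewrite /GRing.regular /=; lra.
have mball n (q : R) : measurable [set w | `|f w - e n| <= q].
  rewrite [X in measurable X](_ : _ =
      \bigcap_m ([set: T] `&` (fun w => phi m (f w) : R) @^-1`
                  [set` `]-oo, q + phi m (e n)]])).
    apply: bigcapT_measurable => m; apply: (mf _ (dphi m)) => //.
  apply/seteqP; split=> w /= H.
    move=> m _; split=> //=; rewrite in_itv /= -lerBlDr -phiB.
    have [_ _ bm] := phiP m; exact: le_trans (ler_norm _) (le_trans (bm _) H).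
  apply: normP => m; have [_] := H m I; rewrite /= in_itv /= -lerBlDr.
  by rewrite phiB.
apply: (@measurability _ _ T (borel B) setT f (@open B) erefl) => _ [U oU <-]; rewrite setTI.
pose good (k : nat * rat) := [set x | `|x - e k.1| <= ratr k.2] `<=` U.
rewrite [X in measurable X](_ : _ = \bigcup_(k : nat * rat)
   (if pselect (good k) then [set w | `|f w - e k.1| <= ratr k.2] else set0)).
  apply: countable_bigcupT_measurable => // k.
  by case: (pselect (good k)) => gk /=; first exact: mball.
apply/seteqP; split=> w /=; last first.
  by move=> [k _]; case: (pselect (good k)) => gk /= H //; exact: gk.
move=> Uw; have /nbhs_ballP[r /= r0 rU] : nbhs (f w : B) U by exact: open_nbhs_nbhs.
have [n nP] := dense_e (f w) (r / 3) (divr_gt0 r0 (ltr0Sn R 2)).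
have r32 : r / 3 < r / 2 by move: r0; lra.
have [q] := rat_in_itvoo r32; rewrite in_itv /= => /andP[q1 q2].
have gk : good (n, q).
  move=> x /= xn; apply: rU; rewrite -ball_normE /=.
  have := ler_distD (e n) (f w) x; rewrite [ `|e n - x| ]distrC.
  by move: nP q2 r0 xn; lra.
exists (n, q) => //; case: (pselect (good (n, q))) => // gk' /=.
by move: nP q1; lra.
Qed.

Lemma measurable_fun_borelB d (T : measurableType d) (f g : T -> borel B) :
  measurable_fun setT f -> measurable_fun setT g ->
  measurable_fun setT (fun w => (f w : B) - (g w : B) : borel B).
Proof.
move=> mf mg; apply: measurable_fun_dual => phi dphi.
rewrite (_ : (fun w => _) = (fun w => phi (f w) - phi (g w))); last first.
  by apply/funext => w; exact: dualB.
by apply: measurable_funB; exact: measurable_dual_comp.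
Qed.

Lemma measurable_fun_borelD d (T : measurableType d) (f g : T -> borel B) :
  measurable_fun setT f -> measurable_fun setT g ->
  measurable_fun setT (fun w => (f w : B) + (g w : B) : borel B).
Proof.
move=> mf mg; apply: measurable_fun_dual => phi dphi.
rewrite (_ : (fun w => _) = (fun w => phi (f w) + phi (g w))); last first.
  by apply/funext => w; exact: dualD.
by apply: measurable_funD; exact: measurable_dual_comp.
Qed.

End BorelDual.

(** * Bounded functions generated by characters *)

Section BoundedClosure.
Context (R : realType) (T : Type).
Implicit Types (K : set (T -> R)) (f g z : T -> R).

(** The inductive presentation of the smallest vector space that contains [K]
    and is closed under bounded pointwise limits: any property stable under these
    operations passes from [K] to the whole space. *)
Inductive bclosure K : (T -> R) -> Prop :=
| bclosure_in f : K f -> bclosure K f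
| bclosure_lin a f g : bclosure K f -> bclosure K g ->
    bclosure K (fun x => a * f x + g x)
| bclosure_lim (F : nat -> T -> R) M f : (forall n, bclosure K (F n)) ->
    (forall n x, `|F n x| <= M) -> (forall x, F n x @[n --> \oo] --> f x) ->
    bclosure K f.

Context (K : set (T -> R)).
Hypothesis K1 : K (fun=> 1).
Hypothesis Kbounded : forall f, K f -> exists M : R, forall x, `|f x| <= M.
Hypothesis KM : forall f g, K f -> K g -> bclosure K (fun x => f x * g x).

Lemma bclosure_ext f g : bclosure K f -> f =1 g -> bclosure K g.
Proof. by move=> kf /funext <-. Qed.

Lemma bclosure_cst c : bclosure K (fun=> c).
Proof.
have H := bclosure_lin (c - 1) (bclosure_in K1) (bclosure_in K1).
by congr (bclosure K _): H; apply/funext => x; rewrite mulr1 subrK.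
Qed.

Lemma bclosureZ a f : bclosure K f -> bclosure K (fun x => a * f x).
Proof.
move=> kf; have H := bclosure_lin a kf (bclosure_cst 0).
by congr (bclosure K _): H; apply/funext => x; rewrite addr0.
Qed.

Lemma bclosureD f g : bclosure K f -> bclosure K g ->
  bclosure K (fun x => f x + g x).
Proof.
move=> kf kg; have H := bclosure_lin 1 kf kg.
by congr (bclosure K _): H; apply/funext => x; rewrite mul1r.
Qed.

Lemma bclosureB f g : bclosure K f -> bclosure K g ->
  bclosure K (fun x => f x - g x).
Proof.
move=> kf kg; have H := bclosure_lin (-1) kg kf.
by congr (bclosure K _): H; apply/funext => x; rewrite mulN1r addrC.
Qed.

Lemma bclosure_bounded f : bclosure K f -> exists M : R, forall x, `|f x| <= M.
Proof.
elim=> [{}f /Kbounded //|a {}f g _ [M fM] _ [N gN]|F M {}f _ _ FM Ff].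
  exists (`|a| * M + N) => x; apply: le_trans (ler_normD _ _) _.
  by rewrite normrM lerD // ler_wpM2l.
exists M => x; have cF : `|F n x| @[n --> \oo] --> `|f x| by apply: cvg_norm.
have -> : `|f x| = limn (fun n => `|F n x|) by apply/esym/cvg_lim.
by apply: limr_le; [exact: cvgP cF|near=> n].
Unshelve. all: by end_near. Qed.

(** The claim is reduced twice by induction, first to a left factor in [K], then
    to both factors in [K]. *)
Lemma bclosureM f g : bclosure K f -> bclosure K g ->
  bclosure K (fun x => f x * g x).
Proof.
have KbM u v : K u -> bclosure K v -> bclosure K (fun x => u x * v x).
  move=> ku; elim=> [{}v|a {}v w _ IHv _ IHw|F M {}v _ IHF FM Fv].
  - exact: KM.
  - have H := bclosure_lin a IHv IHw.
    by congr (bclosure K _): H; apply/funext => x; ring.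
  - have [N uN] := Kbounded ku.
    apply: (bclosure_lim (M := N * M) IHF) => [n x|x].
      by rewrite normrM ler_pM.
    by apply: cvgM (Fv x); exact: cvg_cst.
move=> kf kg; elim: kf => [{}f kf|a {}f h _ IHf _ IHh|F M {}f _ IHF FM Ff].
- exact: KbM.
- have H := bclosure_lin a IHf IHh.
  by congr (bclosure K _): H; apply/funext => x; ring.
- have [N gN] := bclosure_bounded kg.
  apply: (bclosure_lim (M := M * N) IHF) => [n x|x].
    by rewrite normrM ler_pM.
  by apply: cvgM (Ff x) _; exact: cvg_cst.
Qed.

Lemma bclosureX f n : bclosure K f -> bclosure K (fun x => f x ^+ n).
Proof.
move=> kf; elim: n => [|n IH]; first exact: bclosure_cst.
have H := bclosureM kf IH.
by congr (bclosure K _): H; apply/funext => x; rewrite exprS.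
Qed.

(** The polynomials [q_0 = 0, q_(n+1) = q_n + (y^2 - q_n^2) / 2] increase to
    [|y|] on [[-1, 1]]. *)
Fixpoint abs_approx (y : R) n : R :=
  if n is m.+1 then abs_approx y m + 2^-1 * (y ^+ 2 - abs_approx y m ^+ 2)
  else 0.

(** Each step multiplies the gap [|y| - q_n] by [1 - (|y| + q_n) / 2], which is
    at most [1 - |y| / 2]. *)
Lemma abs_approx_bound (y : R) n : `|y| <= 1 ->
  0 <= abs_approx y n <= `|y| /\
  `|y| - abs_approx y n <= `|y| * (1 - `|y| / 2) ^+ n.
Proof.
move=> y1; have y0 := normr_ge0 y.
have [c [c0 c1]] : exists c : R, 0 <= c /\ c = 1 - `|y| / 2.
  by exists (1 - `|y| / 2); split=> //; lra.
rewrite -c1; elim: n => [|n [/andP[q0 qy] IH]] /=.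
  by rewrite expr0 mulr1 subr0 !lexx normr_ge0; split.
have e : c ^+ n.+1 = c * c ^+ n by rewrite exprS.
rewrite -[y ^+ 2]real_normK ?num_real // e.
move: (abs_approx y n) (`|y|) (c ^+ n) q0 qy IH y0 y1 c1 => q a k q0 qa IH a0 a1 c1.
split.
  apply/andP; split; first by nra.
  have : 0 <= (a - q) * (1 - (a + q) / 2) by apply: mulr_ge0; lra.
  by nra.
apply: (@le_trans _ _ ((a - q) * c)).
  have : 0 <= (a - q) * q by apply: mulr_ge0; lra.
  by rewrite c1; nra.
by rewrite [c * k]mulrC mulrA ler_wpM2r.
Qed.

Lemma bclosure_abs z : bclosure K z -> (forall x, `|z x| <= 1) ->
  bclosure K (fun x => `|z x|).
Proof.
move=> kz z1; apply: (@bclosure_lim _ (fun n x => abs_approx (z x) n) 1).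
- elim=> [|n IH] /=; first exact: bclosure_cst.
  by apply: (bclosureD IH); apply: bclosureZ; apply: bclosureB; apply: bclosureX.
- move=> n x; have [/andP[q0 qy] _] := abs_approx_bound n (z1 x).
  by rewrite ger0_norm // (le_trans qy).
- move=> x; have zx := z1 x; have z0 := normr_ge0 (z x).
  have lim0 : `|z x| * (1 - `|z x| / 2) ^+ n @[n --> \oo] --> (0 : R).
    have [->|zn0] := eqVneq `|z x| 0.
      by under eq_cvg do rewrite mul0r; exact: cvg_cst.
    rewrite -(mulr0 `|z x|); apply: cvgM; first exact: cvg_cst.
    apply: cvg_expr; have : 0 < `|z x| by rewrite lt_def zn0.
    by rewrite ltr_norml; lra.
  apply: (@squeeze_cvgr _ _ _ _ (fun n => `|z x| - `|z x| * (1 - `|z x| / 2) ^+ n)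
     (fun=> `|z x|)).
  + apply: nearW => n; have [/andP[q0 qy] h] := abs_approx_bound n zx.
    by rewrite qy andbT; lra.
  + by rewrite -[X in _ --> X]subr0; apply: cvgB lim0; exact: cvg_cst.
  + exact: cvg_cst.
Qed.

(** [1 - (1 - z)^n] tends to [0] where [z = 0] and to [1] where [z > 0]. *)
Lemma bclosure_pos01 z : bclosure K z -> (forall x, 0 <= z x <= 1) ->
  bclosure K (\1_[set x | 0 < z x]).
Proof.
move=> kz z01; apply: (@bclosure_lim _ (fun n x => 1 - (1 - z x) ^+ n) 1).
- move=> n; apply: bclosureB; first exact: bclosure_cst.
  by apply: bclosureX; apply: bclosureB => //; exact: bclosure_cst.
- move=> n x; have /andP[z0 z1] := z01 x.
  have h0 : 0 <= (1 - z x) ^+ n by apply: exprn_ge0; lra.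
  have h1 : (1 - z x) ^+ n <= 1 by apply: exprn_ile1; lra.
  by rewrite ger0_norm; lra.
- move=> x; have /andP[z0 z1] := z01 x; rewrite indicE.
  have [zx|zx] := boolP (0 < z x).
    rewrite mem_set //= -[X in _ --> X]subr0; apply: cvgB; first exact: cvg_cst.
    by apply: cvg_expr; rewrite ltr_norml; lra.
  rewrite memNset /=; last exact/negP.
  have -> : z x = 0 by apply/eqP; rewrite eq_le z0 andbT leNgt.
  by under eq_cvg do rewrite subr0 expr1n subrr; exact: cvg_cst.
Qed.

(** Once [z] is scaled to take values in [[-1, 1]], its positive part
    [(z + |z|) / 2] lies in the closure. *)
Lemma bclosure_pos z : bclosure K z -> bclosure K (\1_[set x | 0 < z x]).
Proof.
move=> kz; have [M zM] := bclosure_bounded kz.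
pose N := Num.max M 1; have N0 : 0 < N by rewrite lt_max ltr01 orbT.
pose w x := N^-1 * z x.
have kw : bclosure K w by exact: bclosureZ.
have w1 x : `|w x| <= 1.
  rewrite normrM gtr0_norm ?invr_gt0 // mulrC ler_pdivrMr // mul1r.
  by rewrite (le_trans (zM x)) // le_max lexx.
have H := bclosure_pos01 (bclosureZ 2^-1 (bclosureD kw (bclosure_abs kw w1))).
have w01 x : 0 <= 2^-1 * (w x + `|w x|) <= 1.
  move: (w1 x); rewrite ler_norml => /andP[h1 h2].
  have [w0|w0] := leP (w x) 0; first by rewrite ler0_norm // subrr mulr0 lexx ler01.
  by rewrite gtr0_norm //; lra.
congr (bclosure K (\1__)): (H w01); apply/funext => x /=.
have <- : (0 < w x) = (0 < z x) by rewrite /w pmulr_rgt0 // invr_gt0.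
have [w0|w0] := leP (w x) 0; first by rewrite ler0_norm // subrr mulr0 ltxx.
by rewrite gtr0_norm // pmulr_rgt0 ?invr_gt0 // addr_gt0.
Qed.

(** Complements are differences. The indicator of a union is the limit of
    [1 - prod_(i < n) (1 - 1_(A i))], and products stay in the closure. *)
Lemma sigma_algebra_bclosure :
  sigma_algebra setT [set A : set T | bclosure K (\1_A)].
Proof.
split => /=.
- by rewrite indic0; exact: bclosure_cst.
- move=> A kA; rewrite setTD.
  have H := bclosureB (bclosure_cst 1) kA.
  congr (bclosure K _): H; apply/funext => x; rewrite !indicE in_setC.
  by case: (x \in A); rewrite /= ?subrr ?subr0.
- move=> A kA.
  apply: (@bclosure_lim _ (fun n x => 1 - \prod_(i < n) (1 - \1_(A i) x)) 1).
  + move=> n; apply: bclosureB; first exact: bclosure_cst.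
    elim: n => [|n IH].
      rewrite (_ : (fun _ => _) = (fun=> 1)); first exact: bclosure_cst.
      by apply/funext => x; rewrite big_ord0.
    have H := bclosureM IH (bclosureB (bclosure_cst 1) (kA n)).
    by congr (bclosure K _): H; apply/funext => x; rewrite big_ord_recr.
  + move=> n x; have : 0 <= \prod_(i < n) (1 - \1_(A i) x : R) <= 1.
      elim/big_rec: _ => [|i p _ /andP[p0 p1]]; first by rewrite ler01 lexx.
      by rewrite indicE; case: (x \in A i);
        rewrite /= ?subrr ?mul0r ?subr0 ?mul1r ?p0 ?p1 ?ler01 ?lexx.
    by move=> /andP[h0 h1]; rewrite ger0_norm; lra.
  + move=> x; rewrite indicE; have [[k _ Ak]|nA] := pselect ((\bigcup_k A k) x).
      rewrite mem_set; last by exists k.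
      apply: (@cvg_near_cst _ _ _ _ _ ); near=> n.
      have kn : (k < n)%N by near: n; exists k.+1.
      by rewrite (bigD1 (Ordinal kn)) //= indicE mem_set //= subrr mul0r subr0.
    rewrite memNset //; apply: cvg_near_cst; apply: nearW => n.
    rewrite big1 ?subrr // => i _; rewrite indicE memNset ?subr0 // => Ai.
    by apply: nA; exists i.
Unshelve. all: by end_near. Qed.

End BoundedClosure.

Section Characters.
Context (R : realType) (T : Type) (Theta : set (T -> R)).
Hypothesis Theta0 : Theta (fun=> 0).
Hypothesis ThetaD : forall f g, Theta f -> Theta g -> Theta (fun x => f x + g x).
Hypothesis ThetaZ : forall a f, Theta f -> Theta (fun x => a * f x).

Definition characters : set (T -> R) :=
  [set f | exists2 th, Theta th & f = (fun x => cos (th x)) \/ f = (fun x => sin (th x))].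

(** The product formulas turn products of cosines and sines of [Theta] into
    linear combinations of such functions. For large [n] the number
    [(th - a) / (n + 1)] lies in [(-pi, pi)], where its sine has the same sign; so
    the indicators of the sets where this sine is positive converge to the
    indicator of [th > a]. *)
Lemma bclosure_characters_sigma (A : set T) :
  <<s [set B | exists th a, Theta th /\ B = [set x | a < th x]] >> A ->
  bclosure characters (\1_A).
Proof.
have K1 : characters (fun=> 1).
  by exists (fun=> 0) => //; left; apply/funext => x; rewrite cos0.
have Kb f : characters f -> exists M : R, forall x, `|f x| <= M.
  move=> [th _ [->|->]]; exists 1 => x; rewrite ler_norml.
    by rewrite cos_geN1 cos_le1.
  by rewrite sin_geN1 sin_le1.
have inK th : Theta th ->
    bclosure characters (fun x => cos (th x)) /\ bclosure characters (fun x => sin (th x)).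
  by move=> h; split; apply: bclosure_in; exists th => //; [left|right].
have ThetaB f g : Theta f -> Theta g -> Theta (fun x => f x - g x).
  move=> Tf Tg; have H := ThetaD Tf (ThetaZ (-1) Tg).
  by congr (Theta _): H; apply/funext => x; rewrite mulN1r.
have KM f g : characters f -> characters g -> bclosure characters (fun x => f x * g x).
  move=> [u Tu fE] [v Tv gE].
  have [cD sD] := inK _ (ThetaD Tu Tv).
  have [cB sB] := inK _ (ThetaB _ _ Tu Tv).
  case: fE => ->; case: gE => ->.
  - have H := bclosureZ K1 2^-1 (bclosureD cD cB).
    by apply: (bclosure_ext H) => x; rewrite cosD cosB; lra.
  - have H := bclosureZ K1 2^-1 (bclosureB sD sB).
    by apply: (bclosure_ext H) => x; rewrite sinD sinB; lra.
  - have H := bclosureZ K1 2^-1 (bclosureD sD sB).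
    by apply: (bclosure_ext H) => x; rewrite sinD sinB; lra.
  - have H := bclosureZ K1 2^-1 (bclosureB cB cD).
    by apply: (bclosure_ext H) => x; rewrite cosB cosD; lra.
have sig := sigma_algebra_bclosure K1 Kb KM.
move: A; apply: smallest_sub => // _ [th [a [Tth ->]]] /=.
pose z n x := sin ((th x - a) / n.+1%:R).
have kz n : bclosure characters (z n).
  have [c s] := inK _ (ThetaZ n.+1%:R^-1 Tth).
  have H := bclosureB (bclosureZ K1 (cos (a / n.+1%:R)) s)
                         (bclosureZ K1 (sin (a / n.+1%:R)) c).
  apply: (bclosure_ext H) => x.
  by rewrite /z mulrBl sinB [n.+1%:R^-1 * _]mulrC; ring.
apply: (@bclosure_lim _ _ _ (fun n => \1_[set x | 0 < z n x]) 1).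
- by move=> n; exact: bclosure_pos.
- by move=> n x; rewrite indicE; case: (_ \in _); rewrite /= ?normr1 ?normr0.
- move=> x; apply: cvg_near_cst; near=> n.
  have npi : `|th x - a| / n.+1%:R < pi.
    rewrite ltr_pdivrMr // -ltr_pdivrMl ?pi_gt0 //.
    rewrite (@lt_le_trans _ _ n%:R) ?ler_nat //; near: n.
    exact: nbhs_infty_gtr.
  suff zE : (0 < z n x) = (a < th x).
    rewrite !indicE; congr (_%:R); congr nat_of_bool.
    by apply/idP/idP; rewrite !inE /= zE.
  have iN : 0 < n.+1%:R^-1 :> R by rewrite invr_gt0.
  rewrite /z -[RHS]subr_gt0 -[RHS](pmulr_lgt0 _ iN).
  move: npi; rewrite -[X in `|_| * X](gtr0_norm iN) -normrM.
  move: ((th x - a) * n.+1%:R^-1) => y ypi.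
  have [y0|y0] := ltP 0 y.
    by apply: sin_gt0_pi; move: ypi; rewrite gtr0_norm // y0.
  apply/negbTE; rewrite -leNgt -oppr_ge0 -sinN; apply: sin_ge0_pi.
  by move: ypi; rewrite ler0_norm // oppr_ge0 y0 /= => /ltW.
Unshelve. all: by end_near. Qed.
End Characters.

(** * Complex random variables and their energy *)

Section SquaredModulus.
Context (R : realType).
Implicit Types x y : R[i].

(** A polynomial in the coordinates, hence measurable without square roots. *)
Definition sqn x : R := complex.Re x ^+ 2 + complex.Im x ^+ 2.

Lemma sqn_ge0 x : 0 <= sqn x. Proof. by rewrite addr_ge0 ?sqr_ge0. Qed.

Lemma sqnE x : normc x ^+ 2 = sqn x.
Proof. by case: x => a b; rewrite /normc sqr_sqrtr // addr_ge0 ?sqr_ge0. Qed.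

Lemma ReM x y : complex.Re (x * y) =
  complex.Re x * complex.Re y - complex.Im x * complex.Im y.
Proof. by case: x y => [a b] [c e]. Qed.

Lemma ImM x y : complex.Im (x * y) =
  complex.Re x * complex.Im y + complex.Im x * complex.Re y.
Proof. by case: x y => [a b] [c e]. Qed.

Lemma ReD x y : complex.Re (x + y) = complex.Re x + complex.Re y.
Proof. by case: x y => [a b] [c e]. Qed.

Lemma ImD x y : complex.Im (x + y) = complex.Im x + complex.Im y.
Proof. by case: x y => [a b] [c e]. Qed.

Lemma ReN x : complex.Re (- x) = - complex.Re x.
Proof. by case: x. Qed.

Lemma ImN x : complex.Im (- x) = - complex.Im x.
Proof. by case: x. Qed.

Lemma sqnM x y : sqn (x * y) = sqn x * sqn y.
Proof. by rewrite /sqn ReM ImM; ring. Qed.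

Lemma sqnD x y : sqn (x + y) <= 2 * (sqn x + sqn y).
Proof.
rewrite /sqn ReD ImD; move: (complex.Re x) (complex.Re y) (complex.Im x) (complex.Im y) => a b c e.
have := sqr_ge0 (a - b); have := sqr_ge0 (c - e); nra.
Qed.

Lemma sqn0 : sqn 0 = 0. Proof. by rewrite /sqn /= expr0n addr0. Qed.

Lemma complex_ext x y : complex.Re x = complex.Re y ->
  complex.Im x = complex.Im y -> x = y.
Proof. by case: x y => [a b] [c e] /= -> ->. Qed.

Lemma sqn_eq0 x : sqn x = 0 -> x = 0.
Proof.
move=> /eqP; rewrite paddr_eq0 ?sqr_ge0 // !sqrf_eq0 => /andP[/eqP h /eqP h'].
exact: complex_ext.
Qed.

End SquaredModulus.

Section ComplexMeasurable.
Context (R : realType) d (T : measurableType d).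
Implicit Types f g : T -> R[i].

Lemma cmeasurable_cst (c : R[i]) : cmeasurable (fun _ : T => c).
Proof. by split; exact: measurable_cst. Qed.

Lemma cmeasurableD f g : cmeasurable f -> cmeasurable g ->
  cmeasurable (fun w => f w + g w).
Proof.
move=> [fr fi] [gr gi]; split.
  by under eq_fun do rewrite ReD; exact: measurable_funD.
by under eq_fun do rewrite ImD; exact: measurable_funD.
Qed.

Lemma cmeasurableM f g : cmeasurable f -> cmeasurable g ->
  cmeasurable (fun w => f w * g w).
Proof.
move=> [fr fi] [gr gi]; split.
  under eq_fun do rewrite ReM.
  by apply: measurable_funB; exact: measurable_funM.
under eq_fun do rewrite ImM.
by apply: measurable_funD; exact: measurable_funM.
Qed.

Lemma cmeasurableB f g : cmeasurable f -> cmeasurable g ->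
  cmeasurable (fun w => f w - g w).
Proof.
move=> mf mg.
rewrite (_ : (fun w => f w - g w) = fun w => f w + (-1) * g w).
  apply: cmeasurableD => //; apply: cmeasurableM => //; exact: cmeasurable_cst.
by apply/funext => w; rewrite mulN1r.
Qed.

Lemma cmeasurable_sum n (f : 'I_n -> T -> R[i]) : (forall i, cmeasurable (f i)) ->
  cmeasurable (fun w => \sum_(i < n) f i w).
Proof.
move=> mf; rewrite (_ : (fun w => _) = \sum_(i < n) f i); last first.
  by apply/funext => w; rewrite fct_sumE.
elim/big_ind: _ => [|g h mg mh|i _]; [exact: cmeasurable_cst|exact: cmeasurableD|exact: mf].
Qed.

Lemma measurable_sqn f : cmeasurable f -> measurable_fun setT (fun w => sqn (f w)).
Proof. by move=> [fr fi]; apply: measurable_funD; exact: measurable_funX. Qed.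

Lemma measurable_esqn f : cmeasurable f ->
  measurable_fun setT (fun w => (sqn (f w))%:E).
Proof. by move=> mf; apply/measurable_EFinP; exact: measurable_sqn. Qed.

End ComplexMeasurable.

Lemma cmeasurable_comp (R : realType) d (T : measurableType d) d' (E : measurableType d')
    (X : T -> E) (F : E -> R[i]) :
  measurable_fun setT X -> cmeasurable F -> cmeasurable (fun w => F (X w)).
Proof.
by move=> mX [mr mi]; split;
  [exact: measurableT_comp mr mX|exact: measurableT_comp mi mX].
Qed.

Section Energy.
Context (R : realType) d (Omega : measurableType d) (P : probability Omega R).
Implicit Types f g : Omega -> R[i].
Local Open Scope ereal_scope.

(** The square of the L2 norm. Its triangle inequality with factor [2] is all
    that closures and limits in L2 require. *)
Definition energy f : \bar R := \int[P]_w (sqn (f w))%:E.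

Lemma energy_ge0 f : 0 <= energy f.
Proof. by apply: integral_ge0 => w _; rewrite lee_fin sqn_ge0. Qed.

Lemma L2normE f : L2norm P f = energy f `^ 2^-1.
Proof.
rewrite /L2norm unlock; congr (_ `^ _); apply: eq_integral => w _.
have n0 : (0 <= normc (f w))%R by case: (f w) => a b; exact: sqrtr_ge0.
by rewrite /= ger0_norm // powR_mulrn // sqnE.
Qed.

Lemma L2norm_lt f (e : R) : (0 < e)%R -> (L2norm P f < e%:E) = (energy f < (e ^+ 2)%:E).
Proof.
move=> e0; rewrite L2normE; have := energy_ge0 f; case: (energy f) => [r r0| |//].
  rewrite poweR_EFin !lte_fin powR12_sqrt //.
  by rewrite -{1}(gtr0_norm e0) -sqrtr_sqr ltr_sqrt ?exprn_gt0.
by rewrite poweRyr // ?invr_neq0.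
Qed.

Lemma L2norm_lty f : (L2norm P f < +oo) = (energy f < +oo).
Proof.
rewrite L2normE; apply/idP/idP; first by apply: lty_poweRy; rewrite invr_neq0.
exact: poweR_lty.
Qed.

Lemma le_energy f (g : Omega -> R) : cmeasurable f -> measurable_fun setT g ->
  (forall w, sqn (f w) <= g w)%R -> energy f <= \int[P]_w (g w)%:E.
Proof.
move=> mf mg fg; apply: ge0_le_integral => //.
- by move=> w _; rewrite lee_fin sqn_ge0.
- exact: measurable_esqn.
- exact/measurable_EFinP.
- by move=> w _; rewrite lee_fin.
Qed.

Lemma energyD f g : cmeasurable f -> cmeasurable g ->
  energy (fun w => (f w + g w)%R) <= 2%:E * (energy f + energy g).
Proof.
move=> mf mg.
apply: (@le_trans _ _ (\int[P]_w (2 * (sqn (f w) + sqn (g w)))%:E)).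
  apply: le_energy.
  - exact: cmeasurableD.
  - by apply: measurable_funM => //; apply: measurable_funD; exact: measurable_sqn.
  - by move=> w; exact: sqnD.
under eq_integral do rewrite EFinM.
have sq0 (h : Omega -> R[i]) w : 0 <= (sqn (h w))%:E by rewrite lee_fin sqn_ge0.
rewrite ge0_integralZl //.
- under eq_integral do rewrite EFinD.
  by rewrite ge0_integralD //; exact: measurable_esqn.
- by apply/measurable_EFinP; apply: measurable_funD; exact: measurable_sqn.
- by move=> w _; rewrite EFinD adde_ge0.
Qed.

Lemma energyZ (c : R[i]) f : cmeasurable f ->
  energy (fun w => (c * f w)%R) = (sqn c)%:E * energy f.
Proof.
move=> mf; rewrite /energy; under eq_integral do rewrite sqnM EFinM.
rewrite ge0_integralZl //; first exact: measurable_esqn.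
- by move=> w _; rewrite lee_fin sqn_ge0.
- by rewrite lee_fin sqn_ge0.
Qed.

Lemma energy_ae f g : cmeasurable f -> cmeasurable g ->
  (\forall w \ae P, f w = g w) -> energy f = energy g.
Proof.
move=> mf mg fg; apply: ae_eq_integral => //; try exact: measurable_esqn.
by apply: filterS fg => w -> _.
Qed.

End Energy.

(** * Measurability up to null sets *)

Lemma preimage_sigma d (T : measurableType d) E (X : T -> E) (G : set (set E)) :
  (forall A, G A -> measurable (X @^-1` A)) ->
  forall A, <<s G >> A -> measurable (X @^-1` A).
Proof.
move=> GX A; move: A; apply: smallest_sub => //; split => /=.
- by rewrite preimage_set0; exact: measurable0.
- move=> A mA; rewrite (_ : X @^-1` _ = ~` (X @^-1` A)); first exact: measurableC.
  by apply/seteqP; split=> w /=; [case|move=> ?; split].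
- by move=> F mF; rewrite preimage_bigcup; exact: bigcupT_measurable.
Qed.

Section Factorization.
Context (R : realType) d (Omega : measurableType d) (P : probability Omega R).
Context d' (E : measurableType d') (X : Omega -> E).

(** Agreeing almost everywhere with a preimage under [X] is stable under
    complements and countable unions. *)
Lemma sigma_algebra_ae_preimage (G : set (set Omega)) :
  (forall A, G A -> exists2 A' : set E, measurable A' &
    \forall w \ae P, A w <-> A' (X w)) ->
  forall A, <<s G >> A -> exists2 A' : set E, measurable A' &
    \forall w \ae P, A w <-> A' (X w).
Proof.
move=> GP A; move: A; apply: smallest_sub => [|A /GP //]; split => /=.
- by exists set0 => //; apply: aeW.
- move=> A [A' mA' AA']; exists (~` A'); first exact: measurableC.
  apply: filterS AA' => w AA'; rewrite /setD /setC /=.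
  by split=> [[_ nA] /AA'|nA']; [|split => // /AA'].
- move=> A /(_ _) /cid2-/all_sig[A' A'P].
  have {A'P}[mA' AA'] := all_and2 A'P.
  exists (\bigcup_k A' k); first exact: bigcupT_measurable.
  have := ae_foralln AA'; apply: filterS => w H.
  by split=> -[k _ Ak]; exists k => //; apply/H.
Qed.

(** The sets [f < q] with [q] rational agree with preimages outside countably
    many null sets, and [f] is the infimum of the rationals above it. *)
Lemma factorization_ae (G : set (set Omega)) (f : Omega -> R) :
  (forall A, G A -> exists2 A' : set E, measurable A' &
    \forall w \ae P, A w <-> A' (X w)) ->
  measurable_fun setT (f : g_sigma_algebraType G -> R) ->
  exists2 F : E -> R, measurable_fun setT F & \forall w \ae P, f w = F (X w).
Proof.
move=> GP mf.
pose q n : R := ratr (odflt 0 (unpickle n)).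
have lev n : exists A' : set E, measurable A' /\
    \forall w \ae P, f w < q n <-> A' (X w).
  have [|A' mA' AA'] := @sigma_algebra_ae_preimage G GP [set w | f w < q n].
    have := mf measurableT [set` `]-oo, q n[]; rewrite setTI.
    by rewrite (_ : f @^-1` _ = [set w | f w < q n]); [exact|rewrite set_itvE].
  by exists A'.
have [A' A'P] := choice lev; have {A'P}[mA' AA'] := all_and2 A'P.
pose g n (x : E) : \bar R := if x \in A' n then (q n)%:E else +oo%E.
have mg n : measurable_fun setT (g n).
  apply: measurable_fun_ifT => //; apply: (measurable_fun_bool true).
  rewrite setTI (_ : _ @^-1` _ = A' n) //.
  by apply/seteqP; split=> x /=; [move/set_mem|move/mem_set].
exists (fun x => fine (einfs (g ^~ x) 0)).
  by apply: measurableT_comp => //; exact: measurable_fun_einfs.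
have := ae_foralln AA'; apply: filterS => w H.
suff -> : einfs (g ^~ (X w)) 0 = (f w)%:E by [].
apply/eqP; rewrite eq_le; apply/andP; split.
  apply/lee_addgt0Pr => e e0.
  have [r] : exists r : rat, ratr r \in `]f w, f w + e[.
    by apply: rat_in_itvoo; rewrite ltrDl.
  rewrite in_itv /= => /andP[fr re].
  apply: (@le_trans _ _ (g (pickle r) (X w))).
    by apply: ereal_inf_lbound; exists (pickle r).
  have qr : q (pickle r) = ratr r by rewrite /q pickleK.
  by rewrite /g mem_set ?qr ?lee_fin ?ltW //; apply/H; rewrite qr.
apply: le_ereal_inf_tmp => _ [n _ <-]; rewrite /g.
case: ifPn => [/set_mem /H fq|_]; last exact: leey.
by rewrite lee_fin ltW.
Qed.

Lemma cfactorization_ae (G : set (set Omega)) (f : Omega -> R[i]) :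
  (forall A, G A -> exists2 A' : set E, measurable A' &
    \forall w \ae P, A w <-> A' (X w)) ->
  @cmeasurable R _ (g_sigma_algebraType G) f ->
  exists2 F : E -> R[i], cmeasurable F & \forall w \ae P, f w = F (X w).
Proof.
move=> GP [mr mi].
have [Fr mFr Hr] := factorization_ae GP mr.
have [Fi mFi Hi] := factorization_ae GP mi.
exists (fun x => Fr x +i* Fi x)%C; first by split.
by apply: filterS2 Hr Hi => w h h'; exact: complex_ext.
Qed.

End Factorization.

Section MeasurableLimits.
Context (R : realType) d (Omega : measurableType d) (P : probability Omega R).
Local Notation C := R[i].

Lemma cmeasurable_sub (G : set (set Omega)) (f : Omega -> C) :
  (forall A, <<s G >> A -> measurable A) ->
  @cmeasurable R _ (g_sigma_algebraType G) f -> cmeasurable f.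
Proof.
move=> GP [mr mi]; split=> _ A mA; apply: GP; [exact: mr|exact: mi].
Qed.

Lemma null_set_ae (N : set Omega) : null_sets P N -> \forall w \ae P, ~ N w.
Proof. by move=> [mN N0]; exists N; split=> // w /= /contrapT. Qed.

(** The sum of the squared moduli has a finite mean, so it is finite almost
    everywhere and its terms tend to [0]. *)
Lemma energy_ae_cvg0 (g : nat -> Omega -> C) : (forall n, cmeasurable (g n)) ->
  (forall n, (energy P (g n) <= (1 / (2 ^ n.+1)%:R)%:E)%E) ->
  \forall w \ae P, sqn (g n w) @[n --> \oo] --> 0.
Proof.
move=> mg Eg; pose S w := (\sum_(n <oo) (sqn (g n w))%:E)%E.
have a0 n w : (0 <= (sqn (g n w))%:E)%E by rewrite lee_fin sqn_ge0.
have mS : measurable_fun setT S.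
  by apply: ge0_emeasurable_sum => // n _; exact: measurable_esqn.
have Sfin : (\int[P]_w S w < +oo)%E.
  rewrite integral_nneseries //; last by move=> n; exact: measurable_esqn.
  apply: (@le_lt_trans _ _ (\sum_(n <oo) (1 / (2 ^ n.+1)%:R)%:E)%E).
    apply: lee_nneseries => [n _ _|n _]; first exact: integral_ge0.
    exact: Eg.
  by apply: le_lt_trans (@epsilon_trick0 R 1 xpredT ler01) _; exact: ltry.
have S0 w : (0 <= S w)%E by apply: nneseries_ge0.
have : P.-integrable setT S.
  apply/integrableP; split=> //.
  by under eq_integral do rewrite gee0_abs //.
move=> /integrable_ae -/(_ measurableT); apply: filterS => w /(_ I) Sw.
apply: cvg_series_cvg_0; apply: nondecreasing_is_cvgn.
  by apply/nondecreasing_seqP => n; rewrite !seriesEord /= big_ord_recr /= lerDl sqn_ge0.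
exists (fine (S w)) => _ [n _ <-]; rewrite -lee_fin fineK // seriesEnat /= -sumEFin.
exact: nneseries_lim_ge.
Qed.

(** The exceptional null set belongs to the sigma-algebra, and so do its
    measurable subsets. *)
Lemma measurable_ae_modification (G : set (set Omega)) (f g : Omega -> R) :
  null_sets P `<=` G -> measurable_fun setT f ->
  measurable_fun setT (g : g_sigma_algebraType G -> R) ->
  (\forall w \ae P, f w = g w) ->
  measurable_fun setT (f : g_sigma_algebraType G -> R).
Proof.
move=> NG mf mg [N [mN N0 fgN]] _ D mD; rewrite setTI.
have fg w : ~ N w -> f w = g w by move=> nN; apply: contrapT => h; apply: nN; exact: fgN.
have nullG A : measurable A -> A `<=` N -> (measurable : set (set (g_sigma_algebraType G))) A.
  move=> mA AN; apply: sub_sigma_algebra; apply: NG; split=> //.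
  by apply/eqP; rewrite eq_le measure_ge0 andbT -N0 le_measure ?inE.
have mgD := mg measurableT D mD; rewrite setTI in mgD.
have mfD := mf measurableT D mD; rewrite setTI in mfD.
rewrite (_ : f @^-1` D = (g @^-1` D `\` N) `|` (f @^-1` D `&` N)).
  apply: (@measurableU _ (g_sigma_algebraType G)).
    by apply: (@measurableD _ (g_sigma_algebraType G)) => //; exact: nullG.
  by apply: nullG; [exact: measurableI|move=> w []].
apply/seteqP; split=> w /=.
  move=> Dw; have [Nw|nN] := pselect (N w); first by right; split.
  by left; split => //; rewrite -(fg _ nN).
by move=> [[Dw nN]|[]//]; rewrite (fg _ nN).
Qed.

(** The upper limit of the sequence is a measurable version of [f]. *)
Lemma measurable_ae_limit (G : set (set Omega)) (f : Omega -> R) (h : nat -> Omega -> R) :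
  null_sets P `<=` G -> measurable_fun setT f ->
  (forall n, measurable_fun setT (h n : g_sigma_algebraType G -> R)) ->
  (\forall w \ae P, h n w @[n --> \oo] --> f w) ->
  measurable_fun setT (f : g_sigma_algebraType G -> R).
Proof.
move=> NG mf mh hf.
pose g w := fine (limn_esup (fun n => (h n w)%:E)).
apply: (@measurable_ae_modification G f g) => //.
  apply: (@measurableT_comp _ _ _ _ _ _ fine) => //.
  apply: (@measurable_fun_limn_esup _ (g_sigma_algebraType G)) => n.
  exact/(@measurable_EFinP _ (g_sigma_algebraType G)).
apply: filterS hf => w hw; rewrite /g.
have hw' : (h n w)%:E @[n --> \oo] --> (f w)%:E by apply: cvg_EFin; [exact: nearW|exact: hw].
by rewrite (cvg_limn_einf_sup hw').2.
Qed.

(** Approximations with summable errors converge almost everywhere. *)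
Lemma cmeasurable_energy_limit (G : set (set Omega)) (f : Omega -> C) :
  null_sets P `<=` G -> G `<=` measurable -> cmeasurable f ->
  (forall e : R, 0 < e -> exists2 h : Omega -> C, @cmeasurable R _ (g_sigma_algebraType G) h &
    (energy P (fun w => (f w - h w)%R) < e%:E)%E) ->
  @cmeasurable R _ (g_sigma_algebraType G) f.
Proof.
move=> NG Gm mf approx.
have /choice[h hP] n : exists h : Omega -> C, @cmeasurable R _ (g_sigma_algebraType G) h /\
    (energy P (fun w => (f w - h w)%R) <= (1 / (2 ^ n.+1)%:R)%:E)%E.
  have [|h mh Eh] := approx (1 / (2 ^ n.+1)%:R); last by exists h; split=> //; exact: ltW.
  by rewrite divr_gt0 // ltr0n expn_gt0.
have mh n : cmeasurable (h n).
  have [mhn _] := hP n; apply: cmeasurable_sub mhn; apply: smallest_sub => //.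
  exact: (@sigma_algebra_measurable _ Omega).
have cvg0 := energy_ae_cvg0 (fun n => cmeasurableB mf (mh n)) (fun n => (hP n).2).
have coord (p : C -> R) w : (forall z, p z ^+ 2 <= sqn z) ->
    (forall z z', p (z - z') = p z - p z') ->
    sqn (f w - h n w) @[n --> \oo] --> 0 -> p (h n w) @[n --> \oo] --> p (f w).
  move=> psqn pB H; apply/cvgrPdist_lt => e e0.
  have e20 : 0 < e ^+ 2 by rewrite exprn_gt0.
  near=> n; have Hn : sqn (f w - h n w) < e ^+ 2 by near: n; exact: (cvgr_lt _ H _ e20).
  rewrite -pB -ltr_sqr ?nnegrE ?normr_ge0 ?ltW //.
  by rewrite real_normK ?num_real // (le_lt_trans (psqn _)).
split.
- apply: (@measurable_ae_limit G _ (fun n w => complex.Re (h n w)) NG mf.1).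
    by move=> n; exact: (hP n).1.1.
  apply: filterS cvg0 => w; apply: coord.
    by move=> z; rewrite lerDl sqr_ge0.
  by move=> z z'; rewrite ReD ReN.
- apply: (@measurable_ae_limit G _ (fun n w => complex.Im (h n w)) NG mf.2).
    by move=> n; exact: (hP n).1.2.
  apply: filterS cvg0 => w; apply: coord.
    by move=> z; rewrite lerDr sqr_ge0.
  by move=> z z'; rewrite ImD ImN.
Unshelve. all: by end_near. Qed.

End MeasurableLimits.

(** * Independence and stationarity on path space *)

Section PiLambda.
Context (R : realType) d (Omega : measurableType d) (P : probability Omega R).

(** Taking the second law from another variable [Y'] lets independence and
    equality in law be extended together: the events [B] that satisfy the product
    formula form a Dynkin system. *)
Lemma pi_lambda_indep (E : Type) (Y Y' : Omega -> E) (C : set Omega)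
    (G : set (set E)) :
  measurable C -> setI_closed G ->
  (forall B, G B -> measurable (Y @^-1` B) /\ measurable (Y' @^-1` B)) ->
  (forall B, G B -> P (C `&` Y @^-1` B) = (P C * P (Y' @^-1` B))%E) ->
  forall B, <<s G >> B -> P (C `&` Y @^-1` B) = (P C * P (Y' @^-1` B))%E.
Proof.
move=> mC GI mG GP B sB.
suff: <<s G >> `<=` [set B | [/\ measurable (Y @^-1` B), measurable (Y' @^-1` B)
    & P (C `&` Y @^-1` B) = (P C * P (Y' @^-1` B))%E]] by move=> /(_ _ sB) [].
apply: lambda_system_subset => //; last first.
  by move=> A GA; have [? ?] := mG _ GA; split=> //; exact: GP.
apply/dynkin_lambda_system; split.
- by split; rewrite ?preimage_setT ?setIT ?probability_setT ?mule1.
- move=> A [mA mA' H]; split.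
    by rewrite preimage_setC; exact: measurableC.
    by rewrite preimage_setC; exact: measurableC.
  have finP S : measurable S -> P S \is a fin_num by move=> mS; exact: fin_num_measure.
  have Cfin := finP _ mC.
  have -> : P (C `&` Y @^-1` (~` A)) = P (C `\` Y @^-1` A) by [].
  have -> : P (Y' @^-1` (~` A)) = (1 - P (Y' @^-1` A))%E by exact: (probability_setC P mA').
  rewrite (measureD mC mA); last by rewrite -ge0_fin_numE.
  transitivity (P C - P (C `&` Y @^-1` A))%E; first by [].
  by rewrite H muleBr // mule1.
- move=> F tF HF; split; rewrite ?preimage_bigcup.
  + by apply: bigcupT_measurable => n; have [] := HF n.
  + by apply: bigcupT_measurable => n; have [] := HF n.
  + have tY (Z : Omega -> E) : trivIset setT (fun n => Z @^-1` F n).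
      by move=> i j _ _ [w [Fi Fj]]; apply: tF => //; exists (Z w).
    have tC : trivIset setT (fun n => C `&` Y @^-1` F n).
      by move=> i j _ _ [w [[_ Fi] [_ Fj]]]; apply: tF => //; exists (Y w).
    have mY n : measurable (Y @^-1` F n) by have [] := HF n.
    have mY' n : measurable (Y' @^-1` F n) by have [] := HF n.
    rewrite setI_bigcupr (measure_bigcup P _ _ _ tC); last first.
      by move=> n _; exact: measurableI.
    rewrite (measure_bigcup P _ _ _ (tY Y')) //.
    have Cf : P C = (fine (P C))%:E by rewrite fineK // fin_num_measure.
    rewrite Cf -nneseriesZl //; apply: eq_eseriesr => n _.
    by rewrite -Cf; have [] := HF n.
Qed.

(** One-sided independence applied in each variable; the left system contains
    the whole space, so that the two laws on the right agree as well. *)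
Lemma indep_pi_systems (E1 E2 : Type) (X : Omega -> E1) (Y Y' : Omega -> E2)
    (G1 : set (set E1)) (G2 : set (set E2)) :
  setI_closed G1 -> setI_closed G2 -> G1 setT ->
  (forall A, <<s G1 >> A -> measurable (X @^-1` A)) ->
  (forall B, <<s G2 >> B -> measurable (Y @^-1` B) /\ measurable (Y' @^-1` B)) ->
  (forall A B, G1 A -> G2 B ->
    P (X @^-1` A `&` Y @^-1` B) = (P (X @^-1` A) * P (Y' @^-1` B))%E) ->
  forall A B, <<s G1 >> A -> <<s G2 >> B ->
    P (X @^-1` A `&` Y @^-1` B) = (P (X @^-1` A) * P (Y' @^-1` B))%E.
Proof.
move=> G1I G2I G1T mX mY H A B sA sB.
have H1 A' : G1 A' ->
    P (X @^-1` A' `&` Y @^-1` B) = (P (X @^-1` A') * P (Y' @^-1` B))%E.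
  move=> GA; apply: (pi_lambda_indep _ G2I) => //.
  - by apply: mX; exact: sub_sigma_algebra.
  - by move=> ? ?; apply: mY; exact: sub_sigma_algebra.
  - by move=> B' GB'; exact: H.
have PY : P (Y @^-1` B) = P (Y' @^-1` B).
  by have := H1 _ G1T; rewrite preimage_setT setTI probability_setT mul1e.
rewrite setIC muleC -PY; apply: (pi_lambda_indep _ G1I) => //.
- by have [] := mY _ sB.
- by move=> A' GA; split; apply: mX; exact: sub_sigma_algebra.
- by move=> A' GA; rewrite setIC muleC PY; exact: H1.
Qed.

End PiLambda.

Lemma partition_through (R : realType) (t : R) (l : seq R) : 0 <= t ->
  (forall r, r \in l -> 0 <= r <= t) ->
  exists N (tt : nat -> R), [/\ tt 0%N = 0, tt N = t,
    forall i, (i < N)%N -> tt i <= tt i.+1 &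
    forall r, r \in l -> exists2 k, (k <= N)%N & tt k = r].
Proof.
move=> t0 lt; pose s := sort <=%R (0 :: t :: l).
have ss : sorted <=%R s by apply: sort_sorted; exact: le_total.
have s01 r : r \in s -> 0 <= r <= t.
  rewrite mem_sort !inE => /or3P[/eqP->|/eqP->|/lt //]; by rewrite lexx t0.
have szs : size s = (size l).+2 by rewrite size_sort.
have leN r : r \in s -> (index r s <= (size l).+1)%N.
  by rewrite -index_mem szs ltnS.
have mono i j : (i <= j)%N -> (j <= (size l).+1)%N -> nth t s i <= nth t s j.
  move=> ij jN; apply: (sorted_leq_nth le_trans le_refl) => //;
  rewrite inE szs ltnS //; exact: leq_trans jN.
have in0 : 0 \in s by rewrite mem_sort inE eqxx.
have int : t \in s by rewrite mem_sort !inE eqxx orbT.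
exists (size l).+1, (nth t s); split.
- have := mono 0%N _ (leq0n _) (leN _ in0); rewrite nth_index // => h.
  apply/eqP; rewrite eq_le h /=.
  by have /s01/andP[] : nth t s 0 \in s by rewrite mem_nth // szs.
- have := mono _ _ (leN _ int) (leqnn _); rewrite nth_index // => h.
  apply/eqP; rewrite eq_le h andbT.
  by have /s01/andP[] : nth t s (size l).+1 \in s by rewrite mem_nth // szs.
- by move=> i iN; apply: mono.
- move=> r rl; have rs : r \in s by rewrite mem_sort !inE rl !orbT.
  by exists (index r s); [exact: leN|rewrite nth_index].
Qed.

Section PathSpace.
Context (R : realType) (B : completeNormedModType R).

(** Events are read off the increments [x r - x 0], so that a path that starts
    away from the origin, such as a shifted one, needs no recentring. *)
Definition path_events (t : R) : set (set (R -> B)) :=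
  \bigcup_(r in [set r : R | 0 <= r <= t])
    preimage_set_system setT (fun x : R -> B => x r - x 0 : borel B) measurable.

Definition path_space (t : R) := g_sigma_algebraType (path_events t).

Definition box n (tt : nat -> R) (A : nat -> set (borel B)) : set (R -> B) :=
  [set x | forall i, (i < n)%N -> A i (x (tt i.+1) - x (tt i))].

(** The independence of increments gives the probabilities of the boxes along
    one partition, and these are stable under intersection. Cylinder sets are
    stable for all times together, but their conditions overlap on increments.
    Hence the passage from boxes to path events takes two steps. *)
Definition boxes n (tt : nat -> R) : set (set (R -> B)) :=
  [set C | exists2 A, (forall i, measurable (A i)) & C = box n tt A].

Lemma boxes_setI n tt : setI_closed (boxes n tt).
Proof.
move=> _ _ [A mA ->] [A' mA' ->]; exists (fun i => A i `&` A' i).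
  by move=> i; exact: measurableI.
apply/seteqP; split=> x /= H.
  by move=> i ni; split; [exact: H.1|exact: H.2].
by split=> i ni; have [] := H _ ni.
Qed.

Definition cylinder_set n (r : nat -> R) (A : nat -> set (borel B)) : set (R -> B) :=
  [set x | forall i, (i < n)%N -> A i (x (r i) - x 0)].

Definition cylinder_sets (t : R) : set (set (R -> B)) :=
  [set C | exists n r A, [/\ forall i, (i < n)%N -> 0 <= r i <= t,
     forall i, measurable (A i) & C = cylinder_set n r A]].

Lemma cylinder_sets_setI t : setI_closed (cylinder_sets t).
Proof.
move=> _ _ [n [r [A [rt mA ->]]]] [n' [r' [A' [rt' mA' ->]]]].
exists (n + n')%N, (fun i => if (i < n)%N then r i else r' (i - n)%N),
  (fun i => if (i < n)%N then A i else A' (i - n)%N); split.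
- move=> i; case: (ltnP i n) => [ni _|ni ni']; first exact: rt.
  by apply: rt'; rewrite ltn_subLR.
- by move=> i; case: ifP.
- apply/seteqP; split=> x /=.
    move=> [H H'] i; case: (ltnP i n) => [ni _|ni ni']; first exact: H.
    by apply: H'; rewrite ltn_subLR.
  move=> H; split=> i ni.
    by have := H i (ltn_addr _ ni); rewrite ni.
  by have := H (n + i)%N; rewrite ltn_add2l [(n + i < n)%N]ltnNge leq_addr /= addKn; apply.
Qed.

Lemma cylinder_setsT t : cylinder_sets t setT.
Proof.
exists 0%N, (fun=> 0), (fun=> setT); split=> //.
by apply/seteqP; split.
Qed.

Lemma path_events_cylinder t : <<s path_events t >> `<=` <<s cylinder_sets t >>.
Proof.
apply: smallest_sub; first exact: smallest_sigma_algebra.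
move=> _ [r rt [A mA <-]]; apply: sub_sigma_algebra.
exists 1%N, (fun=> r), (fun=> A); split=> //.
by rewrite setTI; apply/seteqP; split=> x /= H; [move=> _ _|exact: (H 0%N)].
Qed.

Lemma cylinder_path_events t : cylinder_sets t `<=` <<s path_events t >>.
Proof.
move=> _ [n [r [A [rt mA ->]]]].
suff : measurable (cylinder_set n r A : set (path_space t)) by [].
rewrite (_ : cylinder_set n r A =
    \bigcap_(i in [set i | (i < n)%N]) [set x | A i (x (r i) - x 0)]) //.
apply: bigcap_measurableType => i /= ni; apply: sub_sigma_algebra.
by exists (r i); [exact: rt|exists (A i); rewrite ?setTI].
Qed.

Context (sepB : separable_space B).

(** The value at [tt k] is the sum of the first [k] increments. *)
Lemma measurable_box_value n tt k : (k <= n)%N ->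
  measurable_fun setT
    ((fun x => x (tt k) - x (tt 0%N)) : g_sigma_algebraType (boxes n tt) -> borel B).
Proof.
elim: k => [_|k IH kn].
  apply: (eq_measurable_fun (fun=> 0 : borel B)); last exact: measurable_cst.
  by move=> x _; rewrite subrr.
apply: (eq_measurable_fun
    (fun x : g_sigma_algebraType (boxes n tt) =>
      (x (tt k.+1) - x (tt k)) + (x (tt k) - x (tt 0%N)) : borel B)).
  by move=> x _; rewrite addrA subrK.
apply: measurable_fun_borelD => //; last exact: IH (ltnW kn).
move=> _ A mA; rewrite setTI; apply: sub_sigma_algebra.
exists (fun i => if i == k then A else setT); first by move=> i; case: eqP.
apply/seteqP; split=> x /= H; first by move=> i _; case: eqP => // ->.
by have := H _ kn; rewrite eqxx.
Qed.

(** Sorting the times yields a partition, and the conditions of the cylinder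
    set bear on partial sums of increments along it. *)
Lemma cylinder_set_boxes t C : 0 <= t -> cylinder_sets t C ->
  exists N tt, [/\ tt 0%N = 0, tt N = t,
    forall i, (i < N)%N -> tt i <= tt i.+1 & <<s boxes N tt >> C].
Proof.
move=> t0 [n [r [A [rt mA ->]]]].
have [|N [tt [tt0 ttN ttS ttr]]] := @partition_through _ t (map r (iota 0 n)) t0.
  by move=> _ /mapP[i + ->]; rewrite mem_iota => /andP[_ ni]; exact: rt.
exists N, tt; split=> //.
suff : measurable (cylinder_set n r A : set (g_sigma_algebraType (boxes N tt))) by [].
rewrite (_ : cylinder_set n r A =
    \bigcap_(i in [set i | (i < n)%N]) [set x | A i (x (r i) - x 0)]) //.
apply: bigcap_measurableType => i /= ni.
have [|k kN ktt] := ttr (r i); first by apply: map_f; rewrite mem_iota.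
have := @measurable_box_value N tt k kN measurableT _ (mA i).
by rewrite setTI tt0 ktt.
Qed.

End PathSpace.

Section PathLaw.
Context (R : realType) (B : completeNormedModType R) (sepB : separable_space B).
Context d (Omega : measurableType d) (P : probability Omega R).
Context (L : R -> Omega -> B) (levyL : levy_process P L).

Definition shifted_path (s : R) (w : Omega) : R -> B := fun r => L (s + r) w.

Lemma measurable_increment s t : 0 <= s -> 0 <= t ->
  measurable_fun setT (increment L s t).
Proof.
by move=> s0 t0; apply: measurable_fun_borelB => //; exact: levy_measurable levyL _ _.
Qed.

Lemma measurable_shifted_path s t : 0 <= s ->
  measurable_fun setT (shifted_path s : Omega -> path_space B t).
Proof.
move=> s0 _ A; rewrite setTI; apply: preimage_sigma => _ [r /= /andP[r0 rt] [C mC <-]].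
rewrite setTI.
have := @measurable_increment (s + 0) (s + r) _ _ measurableT C mC.
by rewrite setTI; apply; rewrite addr_ge0.
Qed.

Lemma partition_ge0 n (tt : nat -> R) : tt 0%N = 0 ->
  (forall i, (i < n)%N -> tt i <= tt i.+1) -> forall i, (i <= n)%N -> 0 <= tt i.
Proof.
move=> t0 ttS; elim=> [|i IH] ni; first by rewrite t0.
exact: le_trans (IH (ltnW ni)) (ttS _ ni).
Qed.

Lemma partition_le_last n (tt : nat -> R) :
  (forall i, (i < n)%N -> tt i <= tt i.+1) ->
  forall i, (i <= n)%N -> tt i <= tt n.
Proof.
move=> ttS i ni; have : forall k, (i + k <= n)%N -> tt i <= tt (i + k)%N.
  elim=> [|k IH]; first by rewrite addn0.
  by rewrite addnS => ikn; apply: le_trans (IH (ltnW ikn)) (ttS _ ikn).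
by move=> /(_ (n - i)%N); rewrite subnKC //; exact.
Qed.

Lemma measurable_preimage_box s n tt A : 0 <= s -> tt 0%N = 0 ->
  (forall i, (i < n)%N -> tt i <= tt i.+1) -> (forall i, measurable (A i)) ->
  measurable (shifted_path s @^-1` (box n tt A)).
Proof.
move=> s0 tt0 ttS mA; have tt_ge0 := partition_ge0 tt0 ttS.
rewrite (_ : _ @^-1` _ = \bigcap_(i in [set i | (i < n)%N])
   (increment L (s + tt i) (s + tt i.+1) @^-1` A i)) //.
apply: bigcap_measurableType => i /= ni.
have := @measurable_increment (s + tt i) (s + tt i.+1) _ _ measurableT (A i) (mA i).
by rewrite setTI; apply; apply: addr_ge0 => //; apply: tt_ge0 => //; exact: ltnW.
Qed.

Lemma increment_shift s a b C : 0 <= s -> 0 <= a -> a <= b -> measurable C ->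
  P (increment L (s + a) (s + b) @^-1` C) = P (increment L a b @^-1` C).
Proof.
move=> s0 a0 ab mC; have h0 : 0 <= b - a by rewrite subr_ge0.
have := levy_stationary levyL (addr_ge0 s0 a0) h0 mC.
by rewrite -addrA subrKC => ->; rewrite -(levy_stationary levyL a0 h0 mC) subrKC.
Qed.

(** The partitions of [[0, s]] and of [[s, s + t]] are joined into one, and the
    independence of increments along it splits the product. *)
Lemma box_indep s n m tt uu (A C : nat -> set (borel B)) :
  tt 0%N = 0 -> tt n = s -> (forall i, (i < n)%N -> tt i <= tt i.+1) ->
  uu 0%N = 0 -> (forall i, (i < m)%N -> uu i <= uu i.+1) ->
  (forall i, measurable (A i)) -> (forall i, measurable (C i)) ->
  P (shifted_path 0 @^-1` box n tt A `&` shifted_path s @^-1` box m uu C) =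
  (P (shifted_path 0 @^-1` box n tt A) * P (shifted_path 0 @^-1` box m uu C))%E.
Proof.
move=> tt0 ttn ttS uu0 uuS mA mC.
have s0 : 0 <= s by rewrite -ttn; exact: (partition_ge0 tt0 ttS).
have uu_ge0 := partition_ge0 uu0 uuS.
have boxE k (vv : nat -> R) (D : nat -> set (borel B)) : 0 <= vv 0%N ->
    (forall i, (i < k)%N -> vv i <= vv i.+1) -> (forall i, measurable (D i)) ->
    P [set w | forall i : 'I_k, D i (increment L (vv i) (vv i.+1) w)] =
    (\prod_(i < k) P (increment L (vv i) (vv i.+1) @^-1` D i))%E.
  by move=> v0 vS mD; exact: (levy_independent levyL v0 vS).
have preE k vv (D : nat -> set (borel B)) : shifted_path 0 @^-1` box k vv D =
    [set w | forall i : 'I_k, D i (increment L (vv i) (vv i.+1) w)].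
  apply/seteqP; split=> w /= H i; last move=> ik.
    by have := H i (ltn_ord i); rewrite /shifted_path !add0r.
  by have := H (Ordinal ik); rewrite /shifted_path !add0r.
pose vv i := if (i <= n)%N then tt i else s + uu (i - n)%N.
pose D i := if (i < n)%N then A i else C (i - n)%N.
have vvr j : vv (n + j)%N = s + uu j.
  rewrite /vv; case: j => [|j]; first by rewrite addn0 leqnn ttn uu0 addr0.
  by rewrite leqNgt addnS ltnS leq_addr /= -addnS addKn.
have vvSr j : vv (n + j).+1 = s + uu j.+1 by rewrite -addnS.
have vvl i : (i <= n)%N -> vv i = tt i by rewrite /vv => ->.
have Dl i : (i < n)%N -> D i = A i by rewrite /D => ->.
have Dr j : D (n + j)%N = C j by rewrite /D ltnNge leq_addr /= addKn.
have vvS i : (i < n + m)%N -> vv i <= vv i.+1.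
  have [ni _|ni] := ltnP i n; first by rewrite !vvl ?ttS // ltnW.
  rewrite -(subnKC ni); move: (i - n)%N => j; rewrite ltn_add2l => jm.
  by rewrite vvSr vvr lerD2l; exact: uuS.
have mD i : measurable (D i) by rewrite /D; case: ifP.
have -> : shifted_path 0 @^-1` box n tt A `&` shifted_path s @^-1` box m uu C =
    [set w | forall i : 'I_(n + m), D i (increment L (vv i) (vv i.+1) w)].
  rewrite preE; apply/seteqP; split=> w /=.
    move=> [HA HC] i; have [ni|ni] := ltnP i n.
      by rewrite Dl // !vvl //; [exact: (HA (Ordinal ni))|exact: ltnW].
    have im : (i - n < m)%N by rewrite ltn_subLR.
    have := subnKC ni; move: (i - n)%N im => j jm <-.
    by rewrite Dr vvSr vvr; exact: HC.
  move=> H; split=> [i|j jm].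
    have := H (lshift m i); rewrite /= Dl // !vvl //; exact: ltnW.
  by have := H (rshift n (Ordinal jm)); rewrite /= Dr vvSr vvr.
rewrite boxE //; last by rewrite vvl // tt0.
rewrite big_split_ord /= [in RHS]preE [X in (_ * P X)%E]preE.
rewrite (boxE n tt A) ?tt0 // (boxE m uu C) ?uu0 //; congr (_ * _)%E.
  by apply: eq_bigr => i _; rewrite Dl // !vvl //; exact: ltnW.
apply: eq_bigr => j _; rewrite Dr vvSr vvr.
by apply: increment_shift => //; [exact: uu_ge0 (ltnW _)|exact: uuS].
Qed.

(** The product formula extends from boxes to the sigma-algebra of a partition,
    which contains every cylinder set through its times, and from cylinder sets to
    path events. *)
Lemma shifted_path_indep s t A C : 0 <= s -> 0 <= t ->
  <<s path_events s >> A -> <<s path_events t >> C ->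
  P (shifted_path 0 @^-1` A `&` shifted_path s @^-1` C) =
  (P (shifted_path 0 @^-1` A) * P (shifted_path 0 @^-1` C))%E.
Proof.
move=> s0 t0 /path_events_cylinder sA /path_events_cylinder sC.
have mS r u D : 0 <= r -> <<s cylinder_sets u >> D -> measurable (shifted_path r @^-1` D).
  move=> r0; apply: preimage_sigma => D' /cylinder_path_events mD'.
  have := @measurable_shifted_path r u r0 measurableT _ mD'.
  by rewrite setTI.
apply: (indep_pi_systems (@cylinder_sets_setI _ _ s) (@cylinder_sets_setI _ _ t)) => //.
- exact: cylinder_setsT.
- by move=> D; exact: mS.
- by move=> D mD; split; exact: mS mD.
- move=> A' C' cA cC.
  have [n [tt [tt0 ttn ttS sA']]] := cylinder_set_boxes sepB s0 cA.
  have [m [uu [uu0 uum uuS sC']]] := cylinder_set_boxes sepB t0 cC.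
  apply: (indep_pi_systems (@boxes_setI _ _ n tt) (@boxes_setI _ _ m uu)) => //.
  + exists (fun=> setT) => //.
    by apply/seteqP; split.
  + by apply: preimage_sigma => _ [D mD ->]; exact: measurable_preimage_box.
  + move=> D mD; split; move: D mD; apply: preimage_sigma => _ [D mD ->];
    exact: measurable_preimage_box.
  + move=> _ _ [D mD ->] [D' mD' ->]; exact: box_indep.
Qed.

Lemma shifted_path_stationary s t C : 0 <= s -> 0 <= t ->
  <<s path_events t >> C ->
  P (shifted_path s @^-1` C) = P (shifted_path 0 @^-1` C).
Proof.
move=> s0 t0 sC.
have := @shifted_path_indep s t setT C s0 t0 _ sC.
rewrite !preimage_setT setTI probability_setT mul1e; apply.
exact: (@measurableT _ (path_space B s)).
Qed.

End PathLaw.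

(** * The time shift *)

Section TimeShift.
Context (R : realType) (B : completeNormedModType R) (sepB : separable_space B).
Context d (Omega : measurableType d) (P : probability Omega R).
Context (L : R -> Omega -> B) (levyL : levy_process P L).
Local Notation C := R[i].
Local Notation shifted := (shifted_path L).
Local Notation past := (past P L).
Local Notation between := (between P L).

Lemma past_measurable t A : <<s past t >> A -> measurable A.
Proof.
move: A; apply: smallest_sub; first exact: (@sigma_algebra_measurable _ Omega).
move=> A [[r /= /andP[r0 _] [D mD <-]]|[]//].
exact: (levy_measurable levyL r0).
Qed.

(** [L 0 = 0] almost surely, so the values of the process are its increments
    from time [0]. *)
Lemma past_factorization t f : 0 <= t ->
  @cmeasurable R _ (g_sigma_algebraType (past t)) f ->
  exists2 F : path_space B t -> C, cmeasurable F &
    \forall w \ae P, f w = F (shifted 0 w).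
Proof.
move=> t0; apply: cfactorization_ae => A [[r /= rt [D mD <-]]|/null_set_ae nA]; last first.
  by exists set0 => //; apply: filterS nA => w; split.
exists [set x | D (x r - x 0)].
  by apply: sub_sigma_algebra; exists r => //; exists D; rewrite ?setTI.
have := levy_start levyL; apply: filterS => w L0.
by rewrite setTI /= /shifted_path !add0r L0 subr0.
Qed.

Lemma measurable_path_increment t p q : 0 <= p <= t -> 0 <= q <= t ->
  measurable_fun setT ((fun x => x q - x p) : path_space B t -> borel B).
Proof.
move=> pt qt.
apply: (eq_measurable_fun (fun x : path_space B t => (x q - x 0) - (x p - x 0) : borel B)).
  by move=> x _; rewrite opprB addrA subrK.
apply: measurable_fun_borelB => // _ D mD; apply: sub_sigma_algebra.
  by exists q => //; exists D.
by exists p => //; exists D.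
Qed.

Lemma between_factorization s t f :
  @cmeasurable R _ (g_sigma_algebraType (between s (s + t))) f ->
  exists2 F : path_space B t -> C, cmeasurable F &
    \forall w \ae P, f w = F (shifted s w).
Proof.
apply: cfactorization_ae => A [[[p q] /= [sp pq qt] [D mD <-]]|/null_set_ae nA]; last first.
  by exists set0 => //; apply: filterS nA => w; split.
exists [set x | D (x (q - s) - x (p - s))].
  have := @measurable_path_increment t (p - s) (q - s) _ _ measurableT D mD.
  by rewrite setTI; apply; lra.
by apply: aeW => w; rewrite setTI /= /shifted_path !subrKC.
Qed.

Lemma measurable_shifted_between s t :
  measurable_fun setT
    (shifted s : g_sigma_algebraType (between s (s + t)) -> path_space B t).
Proof.
move=> _ A; rewrite setTI.
apply: (@preimage_sigma _ (g_sigma_algebraType (between s (s + t))) _ (shifted s)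
  (path_events t)).
move=> _ [r /= rt [D mD <-]]; rewrite setTI; apply: sub_sigma_algebra; left.
exists (s + 0, s + r) => /=; first by split; lra.
by exists D; rewrite ?setTI.
Qed.

Lemma measurable_past_increment t p q : 0 <= p <= t -> 0 <= q <= t ->
  measurable_fun setT (increment L p q : g_sigma_algebraType (past t) -> borel B).
Proof.
move=> pt qt; apply: measurable_fun_borelB => // _ D mD; apply: sub_sigma_algebra; left.
  by exists q => //; exists D.
by exists p => //; exists D.
Qed.

Lemma between_past s t A : 0 <= s ->
  <<s between s (s + t) >> A -> <<s past (s + t) >> A.
Proof.
move=> s0; move: A; apply: smallest_sub; first exact: smallest_sigma_algebra.
move=> A [[[p q] /= [sp pq qt] [D mD <-]]|nA]; last by apply: sub_sigma_algebra; right.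
by apply: (@measurable_past_increment (s + t) p q) => //; lra.
Qed.

Lemma measurable_shifted_past t :
  measurable_fun setT
    (shifted 0 : g_sigma_algebraType (past t) -> path_space B t).
Proof.
move=> _ A; rewrite setTI.
apply: (@preimage_sigma _ (g_sigma_algebraType (past t)) _ (shifted 0)
  (path_events t)).
move=> _ [r /= rt [D mD <-]].
have t0 : (0 : R) <= 0 <= t by have /andP[r0 rt'] := rt; rewrite lexx (le_trans r0 rt').
have := @measurable_past_increment t 0 r t0 rt measurableT D mD.
rewrite !setTI (_ : shifted 0 @^-1` _ = increment L 0 r @^-1` D) //.
by rewrite /shifted_path; apply/seteqP; split=> w /=; rewrite !add0r.
Qed.

(** The shifted path has the law of the path itself. *)
Lemma ae_shifted (s t : R) (A : set (R -> B)) : 0 <= s -> 0 <= t ->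
  <<s path_events t >> A ->
  (\forall w \ae P, A (shifted 0 w)) -> \forall w \ae P, A (shifted s w).
Proof.
move=> s0 t0 mA HA.
have mS r : 0 <= r -> measurable (shifted r @^-1` A).
  move=> r0; rewrite -[X in measurable X]setTI.
  by apply: (@measurable_shifted_path _ _ sepB _ _ _ _ levyL r t).
have PE r : 0 <= r -> (\forall w \ae P, A (shifted r w)) <-> P (shifted r @^-1` (~` A)) = 0%E.
  move=> r0; have mC : measurable (shifted r @^-1` (~` A)).
    by rewrite preimage_setC; apply: measurableC; exact: mS.
  split=> [[N [mN N0 AN]]|H]; last by exists (shifted r @^-1` (~` A)); split=> // w.
  apply/(negligibleP P mC); exists N; split; [exact mN|exact N0|exact AN].
apply/(PE _ s0); rewrite (shifted_path_stationary sepB levyL s0 t0); first exact/(PE 0).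
by have := @measurableC _ (path_space B t) A mA.
Qed.

Lemma energy_shifted (s t : R) (F : path_space B t -> C) : 0 <= s -> 0 <= t -> cmeasurable F ->
  energy P (fun w => F (shifted s w)) = energy P (fun w => F (shifted 0 w)).
Proof.
move=> s0 t0 mF.
have mS r : 0 <= r -> measurable_fun setT (shifted r : Omega -> path_space B t).
  by move=> r0; exact: (measurable_shifted_path sepB levyL).
have mF2 : measurable_fun setT (fun x : path_space B t => (sqn (F x))%:E) by exact: measurable_esqn.
have F0 : forall x : path_space B t, (0 <= (sqn (F x))%:E)%E.
  by move=> x; rewrite lee_fin sqn_ge0.
pose law r (r0 : 0 <= r) : {mfun Omega >-> path_space B t} :=
  HB.pack (shifted r) (isMeasurableFun.Build _ _ _ _ _ (mS r r0)).
have E r (r0 : 0 <= r) : energy P (fun w => F (shifted r w)) =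
    (\int[pushforward P (law r r0)]_x (sqn (F x))%:E)%E.
  by rewrite ge0_integral_pushforward.
rewrite (E s s0) (E 0 (lexx 0)); apply: eq_measure_integral => A mA _.
exact: (shifted_path_stationary sepB levyL s0 t0 mA).
Qed.

(** A random variable of the past is a functional [F] of the path, and its time
    shift is [F] evaluated on the shifted path. Since both paths have the same law,
    another choice of [F] changes the shift on a null set only, and norms are
    preserved. *)
Lemma time_shift_exists (s t : R) : 0 <= s -> 0 <= t -> exists S, is_time_shift P L s t S.
Proof.
move=> s0 t0.
pose rep (f : Omega -> C) : set (path_space B t -> C) :=
  [set F : path_space B t -> C | cmeasurable F /\ \forall w \ae P, f w = F (shifted 0 w)].
pose Fn (f : Omega -> C) : path_space B t -> C := xget (fun=> 0) (rep f).
have FnP f F : rep f F -> rep f (Fn f).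
  by move=> h; apply: (@xgetPex _ (fun=> 0) (rep f)); exists F.
have fibP f : fiber P L t f -> rep f (Fn f).
  move=> [mf _]; have [F mF fF] := past_factorization t0 mf.
  by apply: (FnP _ F); split.
have transfer (F G : path_space B t -> C) : cmeasurable F -> cmeasurable G ->
    (\forall w \ae P, F (shifted 0 w) = G (shifted 0 w)) ->
    \forall w \ae P, F (shifted s w) = G (shifted s w).
  move=> mF mG H.
  have mFG := measurable_sqn (cmeasurableB mF mG).
  have : \forall w \ae P, [set x : path_space B t | sqn (F x - G x) = 0] (shifted s w).
    apply: (ae_shifted s0 t0); last first.
      by apply: filterS H => w /= ->; rewrite subrr sqn0.
    have := mFG measurableT [set 0] (measurable_set1 _).
    by rewrite setTI.
  by apply: filterS => w /= /sqn_eq0/eqP; rewrite subr_eq0 => /eqP.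
have shiftedE f F : rep f F -> \forall w \ae P, Fn f (shifted s w) = F (shifted s w).
  move=> rF; have [mF' fF'] := FnP _ _ rF; have [mF fF] := rF.
  by apply: transfer => //; apply: filterS2 fF fF' => w <- <-.
have mP (F : path_space B t -> C) r : 0 <= r -> cmeasurable F ->
    cmeasurable (fun w => F (shifted r w)).
  by move=> r0 mF; apply: cmeasurable_comp mF; exact: (measurable_shifted_path sepB levyL).
have mfib f : fiber P L t f -> cmeasurable f.
  by move=> [mf _]; apply: cmeasurable_sub mf; exact: past_measurable.
have energyE f : cmeasurable f -> rep f (Fn f) ->
    energy P (fun w => Fn f (shifted s w)) = energy P f.
  move=> mf [mF fF]; rewrite energy_shifted //; apply: energy_ae => //.
    by apply: mP.
  by apply: filterS fF => w ->.
exists (fun f w => Fn f (shifted s w)); split.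
- move=> f ff; split.
    apply: (@cmeasurable_comp _ _ (g_sigma_algebraType (between s (s + t))) _ _ _ _
      (@measurable_shifted_between s t)).
    exact: (fibP _ ff).1.
  rewrite L2norm_lty energyE; [|exact: mfib|exact: fibP].
  by rewrite -L2norm_lty; exact: ff.2.
- move=> f g ff fg e; apply: shiftedE; have [mg gG] := fibP _ fg.
  by split => //; apply: filterS2 e gG => w -> ->.
- move=> a f g ff fg; have [mf fF] := fibP _ ff; have [mg gG] := fibP _ fg.
  apply: (@shiftedE _ (fun x => a * Fn f x + Fn g x)); split.
    apply: cmeasurableD => //; apply: cmeasurableM => //; exact: cmeasurable_cst.
  by apply: filterS2 fF gG => w -> ->.
- move=> f ff; rewrite !L2normE energyE //; [exact: mfib|exact: fibP].
- move=> h [mh hoo]; have [F mF hF] := between_factorization mh.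
  have rF : rep (fun w => F (shifted 0 w)) F by split=> //; exact: aeW.
  exists (fun w => F (shifted 0 w)); last first.
    by apply: filterS2 (shiftedE _ _ rF) hF => w -> ->.
  split.
    by apply: (@cmeasurable_comp _ _ (g_sigma_algebraType (past t)) _ _ _ _
      (@measurable_shifted_past t)).
  have mh' : cmeasurable h.
    by apply: cmeasurable_sub mh => A /(between_past s0); exact: past_measurable.
  rewrite L2norm_lty -(energy_shifted s0 t0 mF).
  have := energy_ae mh' (mP _ _ s0 mF) hF => <-.
  by rewrite -L2norm_lty.
- move=> n tt tau tt0 ttn ttS mtau btau.
  have tt01 i : (i <= n)%N -> 0 <= tt i <= t.
    by move=> ni; rewrite (partition_ge0 tt0 ttS ni) /= -ttn (partition_le_last ttS).
  pose F (x : path_space B t) := tau [tuple (x (tt i.+1) - x (tt i) : borel B) | i < n].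
  have rF : rep (cylinder L tt tau 0) F.
    split; last first.
      by apply: aeW => w; rewrite /F /cylinder; congr (tau _); apply: eq_mktuple => i;
        rewrite /increment /shifted_path !add0r !addr0.
    apply: (@cmeasurable_comp _ _ (path_space B t) _ (n.-tuple (borel B)) (fun x =>
      [tuple (x (tt i.+1) - x (tt i) : borel B) | i < n])) mtau.
    apply/measurable_fun_tnthP => i.
    apply: (eq_measurable_fun
      (fun x : path_space B t => x (tt i.+1) - x (tt i) : borel B)).
      by move=> x _; rewrite /= tnth_mktuple.
    by apply: measurable_path_increment; apply: tt01 => //; exact: ltnW.
  apply: filterS (shiftedE _ _ rF) => w ->.
  rewrite /F /cylinder; congr (tau _); apply: eq_mktuple => i.
  by rewrite /increment /shifted_path ![s + _]addrC.
Qed.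

End TimeShift.

(** * Products in the fibres *)

Section IndependentProduct.
Context (R : realType) d (Omega : measurableType d) (P : probability Omega R).
Context d1 d2 (E1 : measurableType d1) (E2 : measurableType d2).
Local Open Scope ereal_scope.

(** The law of the pair is a product measure, to which Tonelli's theorem applies. *)
Lemma integral_indepM (X : Omega -> E1) (Y : Omega -> E2) (f : E1 -> R) (g : E2 -> R) :
  measurable_fun setT X -> measurable_fun setT Y ->
  (forall A C, measurable A -> measurable C ->
    P (X @^-1` A `&` Y @^-1` C) = P (X @^-1` A) * P (Y @^-1` C)) ->
  measurable_fun setT f -> measurable_fun setT g ->
  (forall x, 0 <= f x)%R -> (forall y, 0 <= g y)%R ->
  \int[P]_w (f (X w) * g (Y w))%:E =
    (\int[P]_w (f (X w))%:E) * \int[P]_w (g (Y w))%:E.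
Proof.
move=> mX mY indXY mf mg f0 g0.
pose X' : {mfun Omega >-> E1} := HB.pack X (isMeasurableFun.Build _ _ _ _ _ mX).
pose Y' : {mfun Omega >-> E2} := HB.pack Y (isMeasurableFun.Build _ _ _ _ _ mY).
pose Z : Omega -> E1 * E2 := fun w => (X w, Y w).
have mZ : measurable_fun setT Z by exact: measurable_fun_pair.
pose Z' : {mfun Omega >-> (E1 * E2)%type} := HB.pack Z (isMeasurableFun.Build _ _ _ _ _ mZ).
pose m1 := distribution P X'; pose m2 := distribution P Y'.
have mk : measurable_fun setT (fun z : E1 * E2 => (f z.1 * g z.2)%R).
  by apply: measurable_funM; [exact: measurableT_comp mf (measurable_fst)
    |exact: measurableT_comp mg (measurable_snd)].
have mek : measurable_fun setT (fun z : E1 * E2 => (f z.1 * g z.2)%:E) by exact/measurable_EFinP.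
have k0 (z : E1 * E2) : 0 <= (f z.1 * g z.2)%:E by rewrite lee_fin mulr_ge0.
have mef : measurable_fun setT (fun x => (f x)%:E) by exact/measurable_EFinP.
have meg : measurable_fun setT (fun x => (g x)%:E) by exact/measurable_EFinP.
have ef0 x : 0 <= (f x)%:E by rewrite lee_fin.
have eg0 x : 0 <= (g x)%:E by rewrite lee_fin.
transitivity (\int[pushforward P Z']_z (f z.1 * g z.2)%:E).
  by rewrite ge0_integral_pushforward.
transitivity (\int[m1 \x m2]_z (f z.1 * g z.2)%:E).
  apply: eq_measure_integral => A mA _; apply/esym.
  by apply: product_measure_unique => // D C mD mC; exact: indXY.
rewrite fubini_tonelli1 // /fubini_F /=.
transitivity (\int[m1]_x ((f x)%:E * \int[m2]_y (g y)%:E)).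
  apply: eq_integral => x _; under eq_integral do rewrite EFinM.
  by rewrite ge0_integralZl.
rewrite ge0_integralZr //; last exact: integral_ge0.
by rewrite !ge0_integral_pushforward.
Qed.

End IndependentProduct.

Section UnitProduct.
Context (R : realType) (B : completeNormedModType R) (sepB : separable_space B).
Context d (Omega : measurableType d) (P : probability Omega R).
Context (L : R -> Omega -> B) (levyL : levy_process P L).
Local Notation C := R[i].
Local Notation shifted := (shifted_path L).
Local Notation past := (past P L).
Local Notation between := (between P L).

Lemma time_shiftP (s t : R) : 0 <= s -> 0 <= t -> is_time_shift P L s t (time_shift P L s t).
Proof.
move=> s0 t0; have [S HS] := time_shift_exists sepB levyL s0 t0.
by rewrite /time_shift; case: xgetP => [//|/(_ S)].
Qed.

(** [f] is a functional of the path and [g] one of the path shifted by [s]. *)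
Lemma energy_indepM (s t : R) (f g : Omega -> C) : 0 <= s -> 0 <= t ->
  @cmeasurable R _ (g_sigma_algebraType (past s)) f ->
  @cmeasurable R _ (g_sigma_algebraType (between s (s + t))) g ->
  energy P (fun w => f w * g w) = (energy P f * energy P g)%E.
Proof.
move=> s0 t0 pf bg.
have [F mF fF] := past_factorization levyL s0 pf.
have [G mG gG] := between_factorization sepB bg.
have mS r u : 0 <= r -> measurable_fun setT (shifted r : Omega -> path_space B u).
  by move=> r0; exact: (measurable_shifted_path sepB levyL).
have mf : cmeasurable f by apply: cmeasurable_sub pf; exact: past_measurable.
have mg : cmeasurable g.
  by apply: cmeasurable_sub bg => A /(between_past sepB s0); exact: past_measurable.
have mFX : cmeasurable (fun w => F (shifted 0 w)).
  by apply: cmeasurable_comp mF; exact: mS.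
have mGX : cmeasurable (fun w => G (shifted s w)).
  by apply: cmeasurable_comp mG; exact: mS.
rewrite (energy_ae mf mFX fF) (energy_ae mg mGX gG).
have fgE : \forall w \ae P, f w * g w = F (shifted 0 w) * G (shifted s w).
  have FF : Filter (nbhs (almost_everywhere P)) by exact: ae_filter_ringOfSetsType.
  by apply: (@filterS2 _ _ FF _ _ _ _ fF gG) => w -> ->.
rewrite (energy_ae (cmeasurableM mf mg) (cmeasurableM mFX mGX) fgE).
rewrite /energy; under eq_integral do rewrite sqnM.
apply: (integral_indepM (f := fun x => sqn (F x)) (g := fun x => sqn (G x))
  (mS 0 s (lexx 0)) (mS s t s0)).
- move=> A D mA mD; rewrite (shifted_path_indep sepB levyL s0 t0 mA mD).
  by rewrite (shifted_path_stationary sepB levyL s0 t0 mD).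
- exact: measurable_sqn.
- exact: measurable_sqn.
- by move=> x; exact: sqn_ge0.
- by move=> x; exact: sqn_ge0.
Qed.

Lemma past_mono (s t : R) A : s <= t -> <<s past s >> A -> <<s past t >> A.
Proof.
move=> st; move: A; apply: sub_smallest2r => // A [[r /= /andP[r0 rs] rA]|nA]; [left|by right].
by exists r => //=; rewrite r0 (le_trans rs).
Qed.

(** The product is square-integrable because its factors are independent. *)
Lemma fiber_mult (s t : R) (f g : Omega -> C) : 0 <= s -> 0 <= t ->
  fiber P L s f -> fiber P L t g -> fiber P L (s + t) (mult P L s t f g).
Proof.
move=> s0 t0 [mf foo] fg.
have [bS Soo] := shift_into (time_shiftP s0 t0) fg.
split; last first.
  rewrite L2norm_lty (energy_indepM s0 t0 mf bS).
  move: foo Soo; rewrite !L2norm_lty => h1 h2.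
  by rewrite lte_mul_pinfty ?energy_ge0 // ge0_fin_numE ?energy_ge0.
have pastE (f' : Omega -> C) (u : R) : u <= s + t ->
    @cmeasurable R _ (g_sigma_algebraType (past u)) f' ->
    @cmeasurable R _ (g_sigma_algebraType (past (s + t))) f'.
  by move=> ust [mr mi]; split=> _ A mA; apply: (past_mono ust); [exact: mr|exact: mi].
apply: cmeasurableM; first by apply: pastE mf; rewrite lerDl.
by split=> _ A mA; apply: (between_past sepB s0); [exact: bS.1|exact: bS.2].
Qed.

Lemma unit_product_fiber (t : R) p : unit_product P L t p -> 0 < t /\ fiber P L t p.
Proof.
elim=> [u {}t unitu t0|u s {}t g unitu s0 _ [t0 fg]].
  by split=> //; exact: unit_section.
split; first exact: addr_gt0.
by apply: fiber_mult; rewrite ?ltW //; exact: unit_section.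
Qed.

End UnitProduct.

(** * Characters of the process as units *)

Section Cis.
Context (R : realType).
Implicit Types a b : R.

Definition cis a : R[i] := (cos a +i* sin a)%C.

Lemma cisD a b : cis (a + b) = cis a * cis b.
Proof.
apply: complex_ext; rewrite ?ReM ?ImM /= ?cosD ?sinD //.
by rewrite addrC.
Qed.

Lemma sqn_cis a : sqn (cis a) = 1.
Proof. by rewrite /sqn /= cos2Dsin2. Qed.

Lemma normc_cis a : normc (cis a) = 1.
Proof. by rewrite /normc /= cos2Dsin2 sqrtr1. Qed.

Lemma sqn_cisB a b : sqn (cis a - cis b) = 2 - 2 * cos (a - b).
Proof.
rewrite /sqn ReD ImD ReN ImN /= cosB.
have := cos2Dsin2 a; have := cos2Dsin2 b; nra.
Qed.

Lemma cmeasurable_cis d (T : measurableType d) (f : T -> R) :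
  measurable_fun setT f -> cmeasurable (fun w => cis (f w)).
Proof.
by move=> mf; split; apply: measurableT_comp mf; apply: continuous_measurable_fun;
  [exact: continuous_cos|exact: continuous_sin].
Qed.

Lemma energy_cis d (Omega : measurableType d) (P : probability Omega R) (f : Omega -> R) :
  energy P (fun w => cis (f w)) = 1%E.
Proof.
rewrite /energy; under eq_integral do rewrite sqn_cis.
by rewrite integral_cst //= probability_setT mule1.
Qed.

End Cis.

Section Phases.
Context (R : realType) (B : completeNormedModType R) (sepB : separable_space B).
Context d (Omega : measurableType d) (P : probability Omega R).
Context (L : R -> Omega -> B) (levyL : levy_process P L).
Local Notation C := R[i].
Local Notation past := (past P L).

(** A list of durations and functionals stands for a step path in the dual,
    and [phase] for its integral against the process from time [s] on. *)
Definition step := (R * (B -> R^o))%type.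

Fixpoint phase (l : seq step) (s : R) (w : Omega) : R :=
  if l is (t, phi) :: l' then phi (L (s + t) w - L s w) + phase l' (s + t) w else 0.

Fixpoint total (l : seq step) : R := if l is (t, _) :: l' then t + total l' else 0.

Fixpoint admissible (l : seq step) : Prop :=
  if l is (t, phi) :: l' then [/\ 0 < t, dual phi & admissible l'] else True.

Fixpoint times (l : seq step) (i : nat) : R :=
  match i, l with
  | j.+1, (t, _) :: l' => t + times l' j
  | _, _ => 0
  end.

Definition functional (l : seq step) (i : nat) : B -> R^o := (nth (0, cst 0) l i).2.

Lemma total_ge0 l : admissible l -> 0 <= total l.
Proof. by elim: l => //= -[t phi] l IH [t0 _ /IH]; apply: addr_ge0; exact: ltW. Qed.

Lemma times0 l : times l 0 = 0.
Proof. by case: l. Qed.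

Lemma times_total l : times l (size l) = total l.
Proof. by elim: l => //= -[t phi] l ->. Qed.

Lemma times_le l i : admissible l -> (i < size l)%N -> times l i <= times l i.+1.
Proof.
elim: l i => //= -[t phi] l IH [|i] [t0 _ al] il.
  by rewrite times0 addr0 ltW.
by rewrite lerD2l; exact: IH.
Qed.

Lemma phaseE l s w : phase l s w =
  \sum_(i < size l) functional l i (increment L (times l i + s) (times l i.+1 + s) w).
Proof.
elim: l s => [|[t phi] l IH] s /=; first by rewrite big_ord0.
rewrite big_ord_recl /= /increment times0 addr0 add0r [t + s]addrC; congr (_ + _).
rewrite IH; apply: eq_bigr => i _; rewrite /functional /increment /=.
by rewrite ![s + t]addrC !addrA ![times _ _ + t]addrC.
Qed.

Lemma admissible_dual l i : admissible l -> (i < size l)%N -> dual (functional l i).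
Proof.
by elim: l i => //= -[t phi] l IH [|i] [t0 dphi al] //= il; apply: IH.
Qed.

(** The phase is a function of the increments along [times l], so its character
    is a cylinder function. *)
Lemma time_shift_phase l s : admissible l -> 0 <= s ->
  \forall w \ae P, time_shift P L s (total l) (fun w => cis (phase l 0 w)) w = cis (phase l s w).
Proof.
move=> al s0; pose n := size l.
pose tau (x : n.-tuple (borel B)) : C := cis (\sum_(i < n) functional l i (tnth x i)).
have mtau : cmeasurable tau.
  apply: cmeasurable_cis; apply: measurable_sum => i.
  apply: measurable_dual_comp; last exact: measurable_tnth.
  exact: admissible_dual.
have btau : cbounded tau by exists 1 => x; rewrite normc_cis.
have cylE r : cylinder L (times l) tau r = (fun w => cis (phase l r w)).
  apply/funext => w; rewrite /cylinder /tau phaseE; congr cis.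
  by apply: eq_bigr => i _; rewrite tnth_mktuple.
have := shift_cylinder (time_shiftP sepB levyL s0 (total_ge0 al)) (times0 l)
  (times_total l) (fun i => @times_le l i al) mtau btau.
by rewrite !cylE.
Qed.

Lemma measurable_phase l t : admissible l -> total l = t ->
  measurable_fun setT (phase l 0 : g_sigma_algebraType (past t) -> R).
Proof.
move=> al lt.
have -> : phase l 0 = fun w => \sum_(i < size l) functional l i
    (increment L (times l i) (times l i.+1) w).
  by apply/funext => w; rewrite phaseE; under eq_bigr do rewrite !addr0.
apply: (@measurable_sum _ (g_sigma_algebraType (past t))) => i.
apply: (@measurable_dual_comp _ _ _ (g_sigma_algebraType (past t))).
  exact: admissible_dual.
have ttS j := @times_le l j al.
have tE j : (j <= size l)%N -> 0 <= times l j <= t.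
  move=> jl; rewrite (partition_ge0 (times0 l) ttS jl) /= -lt -times_total.
  by rewrite (partition_le_last ttS).
by apply: measurable_past_increment => //; apply: tE => //; exact: ltnW.
Qed.

Lemma fiber_phase l t : admissible l -> total l = t ->
  fiber P L t (fun w => cis (phase l 0 w)).
Proof.
move=> al lt; split; last by rewrite L2norm_lty energy_cis ltry.
by apply: cmeasurable_cis; exact: measurable_phase.
Qed.

(** The step of [l] that contains [r] is cut there, and [phi] is added to all the
    functionals before the cut. *)
Lemma phase_add l s r phi : admissible l -> dual phi -> 0 < r -> r <= total l ->
  exists l', [/\ admissible l', total l' = total l &
    forall w, phase l' s w = phi (L (s + r) w - L s w) + phase l s w].
Proof.
move=> + dphi; elim: l s r => [|[t psi] l IH] s r /=; first by move=> _ r0; lra.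
move=> [t0 dpsi al] r0 rt.
have dsum : dual (fun x => phi x + psi x).
  have [lp cp] := dphi; have [lq cq] := dpsi; split.
    move=> a x y; rewrite lp lq scalerDr addrACA.
    by [].
  by move=> x; apply: cvgD; [exact: cp|exact: cq].
have [rlt|tr|rt'] := ltgtP r t.
- exists ((r, fun x => phi x + psi x) :: (t - r, psi) :: l) => /=; split.
  + by split => //; split => //; rewrite subr_gt0.
  + by rewrite addrA subrKC.
  + move=> w; rewrite -[s + r + _]addrA subrKC !(dualB _ _ dpsi).
    move: (psi _ : R) (psi _ : R) (psi _ : R) (phi _ : R) (phase _ _ _) => a b c e f.
    by rewrite /GRing.regular /=; lra.
- have rt0 : 0 < r - t by rewrite subr_gt0.
  have rtl : r - t <= total l by rewrite lerBlDl.
  have [l' [al' tl' pl']] := IH (s + t) (r - t) al rt0 rtl.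
  exists ((t, fun x => phi x + psi x) :: l') => /=; split=> //; first by rewrite tl'.
  move=> w; rewrite pl' -[s + t + _]addrA subrKC.
  rewrite !(dualB _ _ dphi).
  move: (phi _ : R) (phi _ : R) (phi _ : R) (psi _ : R) (phase _ _ _) => a b c e f.
  by rewrite /GRing.regular /=; lra.
- exists ((t, fun x => phi x + psi x) :: l) => /=; split=> //.
  by move=> w; rewrite rt' addrA.
Qed.

Definition character_unit (phi : B -> R^o) (t : R) (w : Omega) : C := cis (phi (L t w)).

Lemma character_unit_phase phi t : dual phi ->
  \forall w \ae P, character_unit phi t w = cis (phase [:: (t, phi)] 0 w).
Proof.
move=> dphi; have := levy_start levyL; apply: filterS => w L0.
by rewrite /character_unit /= add0r L0 subr0 addr0.
Qed.

Lemma character_unit_fiber phi t : dual phi -> 0 < t -> fiber P L t (character_unit phi t).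
Proof.
move=> dphi t0; split; last by rewrite L2norm_lty energy_cis ltry.
apply: (@cmeasurable_cis _ _ (g_sigma_algebraType (past t))).
apply: (@measurable_dual_comp _ _ _ (g_sigma_algebraType (past t))) => // _ D mD.
apply: sub_sigma_algebra; left; exists t; last by exists D.
by rewrite /= lexx ltW.
Qed.

(** [L (s + t)] is the sum of [L s] and of the shift of [L t], and characters
    turn sums into products. *)
Lemma character_unit_mult phi s t : dual phi -> 0 < s -> 0 < t ->
  \forall w \ae P, character_unit phi (s + t) w =
    mult P L s t (character_unit phi s) (character_unit phi t) w.
Proof.
move=> dphi s0 t0.
have al : admissible [:: (t, phi)] by split.
have tl : total [:: (t, phi)] = t by rewrite /= addr0.
have S1 := shift_ae (time_shiftP sepB levyL (ltW s0) (ltW t0))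
  (character_unit_fiber dphi t0) (fiber_phase al tl) (character_unit_phase t dphi).
have S2 := time_shift_phase al (ltW s0); rewrite tl in S2.
apply: filterS2 S1 S2 => w e1 e2; rewrite /mult e1 e2 /= addr0 -cisD.
by rewrite (dualB _ _ dphi) subrKC.
Qed.

Lemma ae_false (A : Prop) : (\forall w \ae P, A) -> A.
Proof.
move=> [N [mN N0 AN]]; apply: contrapT => nA.
have : P setT = 0%E.
  apply/eqP; rewrite eq_le measure_ge0 andbT -N0 le_measure ?inE // => w _.
  exact: AN.
by rewrite probability_setT => /eqP; rewrite onee_eq0.
Qed.

(** The squared distance is the mean of [2 - 2 cos (phi (L t - L s))], small
    where [L t - L s] is small and at most [4] elsewhere; stochastic continuity
    makes the second event improbable. *)
Lemma character_unit_continuous phi (t e : R) : dual phi -> 0 < t -> 0 < e ->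
  \forall s \near t, 0 < s /\
    (L2norm P (fun w => (character_unit phi t w - character_unit phi s w)%R) < e%:E)%E.
Proof.
move=> dphi t0 e0.
(* The two contributions will be at most [c] and [4 * c]. *)
have [c [c0 e2]] : exists c : R, 0 < c /\ e ^+ 2 = 8 * c.
  by exists (e ^+ 2 / 8); split; [rewrite divr_gt0 ?exprn_gt0|field].
have [delta delta0 Hdelta] : exists2 delta : R, 0 < delta &
    forall x : B, `|x| <= delta -> 2 - 2 * cos (phi x) <= c.
  have cphi : (fun x : B => 2 - 2 * cos (phi x)) x @[x --> (0 : B)] --> (0 : R).
    have -> : 0 = 2 - 2 * cos (phi 0) :> R.
      by have := dualB 0 0 dphi; rewrite !subrr => ->; rewrite cos0 mulr1 subrr.
    apply: cvgB; first exact: cvg_cst.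
    apply: cvgM; first exact: cvg_cst.
    by apply: continuous_comp; [exact: dphi.2|exact: continuous_cos].
  have /nbhs_ballP[r /= r0 Hr] : \forall x \near (0 : B), 2 - 2 * cos (phi x) <= c.
    exact: (cvgr_le _ cphi _ c0).
  exists (r / 2); first exact: divr_gt0.
  move=> x xr; apply: Hr; rewrite -ball_normE /= sub0r normrN.
  by apply: le_lt_trans xr _; rewrite ltr_pdivrMr // ltr_pMr // ltr1n.
have /fine_cvgP[_ Hfine] := levy_stochastically_continuous levyL (ltW t0) delta0.
have := cvgr_lt _ Hfine _ c0; rewrite near_withinE => Hnear.
near=> s.
have s0 : 0 < s by near: s; exact: lt_nbhsr.
split=> //.
have small : fine (P [set w | delta < `|L s w - L t w|]) < c.
  by move: (ltW s0); near: s; exact: Hnear.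
pose A := [set w | delta < `|L s w - L t w|].
have mA : measurable A.
  have := @measurable_increment _ _ sepB _ _ _ _ levyL t s (ltW t0) (ltW s0) measurableT
    [set x : B | delta < `|x|].
  rewrite setTI; apply; apply: sub_sigma_algebra.
  rewrite (_ : mkset _ = (fun x : B => `|x|) @^-1` [set x | delta < x]) //.
  by apply: open_comp; [move=> x _; exact: norm_continuous|exact: open_gt].
have mphi r : 0 <= r -> measurable_fun setT (fun w => phi (L r w) : R).
  by move=> r0; apply: measurable_dual_comp => //; exact: levy_measurable levyL _ r0.
have mdiff : cmeasurable (fun w => character_unit phi t w - character_unit phi s w).
  by apply: cmeasurableB; apply: cmeasurable_cis; apply: mphi; exact: ltW.
rewrite L2norm_lt //.
have bound w : sqn (character_unit phi t w - character_unit phi s w) <=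
    c + 4 * \1_A w.
  rewrite sqn_cisB -(dualB _ _ dphi) indicE.
  have [wA|wA] := boolP (w \in A).
    by rewrite mulr1; have := cos_geN1 (phi (L t w - L s w)); move: c0; lra.
  rewrite mulr0 addr0; apply: Hdelta; rewrite distrC leNgt.
  by apply: contra wA => h; rewrite inE.
have mg : measurable_fun setT (fun w => c + 4 * \1_A w : R).
  by apply: measurable_funD => //; apply: measurable_funM => //; exact: measurable_indic.
apply: le_lt_trans (le_energy P mdiff mg bound) _.
under eq_integral do rewrite EFinD EFinM.
rewrite ge0_integralD //; last 2 first.
- by move=> w _; rewrite lee_fin ltW.
- apply/measurable_EFinP; apply: measurable_funM => //; exact: measurable_indic.
rewrite integral_cst //= probability_setT mule1 ge0_integralZl //; last first.
  by apply/measurable_EFinP; exact: measurable_indic.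
have -> : (\int[P]_x (\1_A x)%:E = (fine (P A))%:E)%E.
  by rewrite integral_indic // setIT fineK // fin_num_measure.
rewrite -EFinM -EFinD lte_fin.
by rewrite e2; move: small c0; rewrite -/A; lra.
Unshelve. all: by end_near. Qed.

(** Mean square continuity makes the preimages of open sets open, which gives
    the Borel section. *)
Lemma character_unit_is_unit phi : dual phi -> is_unit P L (character_unit phi).
Proof.
move=> dphi; split.
- by move=> t t0; exact: character_unit_fiber.
- have mu : measurable_fun (`]0, +oo[%classic : set R)
      (character_unit phi : R -> L2_borel P).
    apply: (@measurability _ _ R (L2_borel P) _ _ (L2_open P) erefl) => _ [A [AL2 oA] <-].
    apply: open_measurable; rewrite openE => t /=; rewrite in_itv /= andbT.
    move=> -[t0 /oA[e e0 HA]].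
    apply: filterS (character_unit_continuous dphi t0 e0) => s [s0 us].
    split; first by rewrite /= in_itv /= andbT.
    apply: HA us; have [ms sfin] := character_unit_fiber dphi s0.
    split=> //; split.
      by move=> _ D mD; apply: sub_sigma_algebra; apply: (past_measurable levyL); exact: ms.1.
    by move=> _ D mD; apply: sub_sigma_algebra; apply: (past_measurable levyL); exact: ms.2.
  apply: (@measurability _ _ R (measurableTypeR R * L2_borel P)%type _ _ _
    (measurable_prod_measurableType _ _)).
  move=> _ [_ [A mA [C mC <-]] <-].
  rewrite (_ : _ `&` _ = (`]0, +oo[ `&` A) `&` (`]0, +oo[ `&` character_unit phi @^-1` C)).
    by apply: measurableI; [exact: measurableI|exact: mu].
  by apply/seteqP; split=> t /=; [case=> ? []|case=> -[? ?] [? ?]].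
- exists 1 => // /(filterS _) h; apply: (@ae_false False); apply: h => w /(congr1 (@sqn R)).
  by rewrite sqn_cis sqn0 => /eqP; rewrite oner_eq0.
- by move=> s t s0 t0; exact: character_unit_mult.
Qed.

(** The first step contributes the value of a unit, and the remaining ones are
    shifted by its duration. *)
Lemma phase_unit_product l : admissible l -> 0 < total l ->
  exists2 p, unit_product P L (total l) p & \forall w \ae P, p w = cis (phase l 0 w).
Proof.
elim: l => [_|[t phi] l IH] /=; first by rewrite ltxx.
move=> [t0 dphi al] _; have unit_phi := character_unit_is_unit dphi.
case: l IH al => [_ _|st l IH al].
  exists (character_unit phi t); last exact: character_unit_phase.
  by rewrite /= addr0; exact: unit_product1.
have ltot : 0 < total (st :: l).
  by case: st {IH} al => r psi [r0 _ al]; rewrite /= ltr_wpDr ?total_ge0.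
have [p up pE] := IH al ltot.
exists (mult P L t (total (st :: l)) (character_unit phi t) p).
  exact: unit_productS.
have [_ fp] := unit_product_fiber sepB levyL up.
have S1 := shift_ae (time_shiftP sepB levyL (ltW t0) (ltW ltot)) fp (fiber_phase al erefl) pE.
have S2 := time_shift_phase al (ltW t0).
have := character_unit_phase t dphi; apply: filterS3 S1 S2 => w e1 e2 e3.
by rewrite /mult e1 e2 e3 /= addr0 cisD add0r.
Qed.

End Phases.

(** * Density of the products *)

Section SpanInFiber.
Context (R : realType) (B : completeNormedModType R) (sepB : separable_space B).
Context d (Omega : measurableType d) (P : probability Omega R).
Context (L : R -> Omega -> B) (levyL : levy_process P L).

Lemma L2_cmeasurable (f : Omega -> R[i]) : L2 P measurable f -> cmeasurable f.
Proof.
move=> [mf _]; apply: cmeasurable_sub mf; apply: smallest_sub => //.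
exact: (@sigma_algebra_measurable _ Omega).
Qed.

(** The sigma-algebra of the past contains the null sets, so it keeps L2 limits
    measurable. *)
Lemma closed_span_fiber (t : R) :
  closed_span P (unit_product P L t) `<=` fiber P L t.
Proof.
move=> f [L2f approx]; split; last exact: L2f.2.
apply: (@cmeasurable_energy_limit _ _ _ P).
- by move=> N nN; right.
- by move=> A PA; apply: (past_measurable levyL); exact: sub_sigma_algebra PA.
- exact: (L2_cmeasurable L2f).
- move=> e e0; have se0 : 0 < Num.sqrt e by rewrite sqrtr_gt0.
  have [n [c [p [pu Lp]]]] := approx _ se0.
  exists (fun w => \sum_(i < n) c i * p i w).
    apply: (@cmeasurable_sum _ _ (g_sigma_algebraType (past P L t))) => i.
    apply: (@cmeasurableM _ _ (g_sigma_algebraType (past P L t))).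
      exact: cmeasurable_cst.
    by have [_ [+ _]] := unit_product_fiber sepB levyL (pu i).
  by rewrite -(sqr_sqrtr (ltW e0)) -L2norm_lt.
Qed.

End SpanInFiber.

Section ClosedSpan.
Context (R : realType) d (Omega : measurableType d) (P : probability Omega R).
Local Notation C := R[i].

(** Dominated convergence for the squared errors. *)
Lemma energy_dominated (f k : Omega -> R) (F : nat -> Omega -> R) :
  measurable_fun setT f -> (forall n, measurable_fun setT (F n)) ->
  measurable_fun setT k -> (forall n w, (f w - F n w) ^+ 2 <= k w) ->
  (\int[P]_w (k w)%:E < +oo)%E ->
  (forall w, F n w @[n --> \oo] --> f w) ->
  forall e : R, 0 < e -> exists n,
    (energy P (fun w => ((f w)%:C%C - (F n w)%:C%C)%R) < e%:E)%E.
Proof.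
move=> mf mF mk Fk kfin Ff e e0.
have sE n w : sqn ((f w)%:C%C - (F n w)%:C%C) = (f w - F n w) ^+ 2.
  by rewrite /sqn ReD ImD ReN ImN /= subr0 expr0n addr0.
have k0 w : 0 <= k w by apply: le_trans (Fk 0%N w); exact: sqr_ge0.
have [|||||_ _] := @dominated_convergence _ Omega R P setT measurableT
    (fun n w => ((f w - F n w) ^+ 2)%:E) (fun=> 0%E) (fun w => (k w)%:E).
- by move=> n; apply/measurable_EFinP; apply: measurable_funX; exact: measurable_funB.
- exact: measurable_cst.
- apply: aeW => w _; apply: cvg_EFin; first exact: nearW.
  have h : (f w - F n w) @[n --> \oo] --> (0 : R).
    by rewrite -(subrr (f w)); apply: cvgB => //; exact: cvg_cst.
  by have := cvgM h h; rewrite mulr0; exact.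
- apply/integrableP; split; first exact/measurable_EFinP.
  by under eq_integral do rewrite gee0_abs ?lee_fin //.
- apply: aeW => w n _; rewrite gee0_abs ?lee_fin ?sqr_ge0 //; exact: Fk.
rewrite integral0 => H.
have /fine_cvgP[Hfin H0] := H.
have near_lt := cvgr_lt _ H0 _ e0.
near \oo => n; exists n.
rewrite /energy; under eq_integral do rewrite sE.
have Hn : fine (\int[P]_w ((f w - F n w) ^+ 2)%:E) < e by near: n; exact: near_lt.
have Hf : (\int[P]_w ((f w - F n w) ^+ 2)%:E)%E \is a fin_num by near: n; exact: Hfin.
by rewrite -(fineK Hf) lte_fin.
Unshelve. all: by end_near. Qed.

Context (A : set (Omega -> C)).
Hypothesis mA : forall p, A p -> cmeasurable p.

Definition in_span (h : Omega -> C) : Prop :=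
  exists n (c : 'I_n -> C) (p : 'I_n -> Omega -> C),
    (forall i, A (p i)) /\ h = (fun w => \sum_(i < n) c i * p i w).

Lemma in_span_cmeasurable h : in_span h -> cmeasurable h.
Proof.
move=> [n [c [p [Ap ->]]]]; apply: cmeasurable_sum => i.
by apply: cmeasurableM; [exact: cmeasurable_cst|exact: mA].
Qed.

Lemma in_span_lin (a : C) h g : in_span h -> in_span g ->
  in_span (fun w => a * h w + g w).
Proof.
move=> [n [c [p [Ap ->]]]] [m [c' [p' [Ap' ->]]]].
exists (n + m)%N, (fun i => match fintype.split i with inl j => a * c j | inr j => c' j end),
  (fun i => match fintype.split i with inl j => p j | inr j => p' j end); split.
  by move=> i; case: fintype.split.
apply/funext => w; rewrite big_split_ord /= mulr_sumr; congr (_ + _).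
  apply: eq_bigr => i _; case: fintype.splitP => j /= ij.
    by rewrite mulrA (_ : i = j) //; exact: val_inj.
  by have := ltn_ord i; rewrite ij ltnNge leq_addr.
apply: eq_bigr => i _; case: fintype.splitP => j /= ij.
  by have := ltn_ord j; rewrite -ij ltnNge leq_addr.
by rewrite (_ : i = j) //; apply: val_inj => /=; apply/eqP; rewrite -(eqn_add2l n) ij.
Qed.

(** Closeness is measured by the energy, which spares square roots. *)
Definition approximable (f : Omega -> C) : Prop :=
  cmeasurable f /\ forall e : R, 0 < e ->
    exists2 h, in_span h & (energy P (fun w => (f w - h w)%R) < e%:E)%E.

Lemma approximable_limit f : cmeasurable f ->
  (forall e : R, 0 < e -> exists2 g, approximable g &
     (energy P (fun w => (f w - g w)%R) < e%:E)%E) -> approximable f.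
Proof.
move=> mf H; split=> // e e0; have e40 : 0 < e / 4 by rewrite divr_gt0.
have [g [mg gapp] fg] := H _ e40; have [h hs gh] := gapp _ e40; exists h => //.
have mh := in_span_cmeasurable hs.
have -> : (fun w => f w - h w) = (fun w => (f w - g w) + (g w - h w)).
  by apply/funext => w; rewrite addrA subrK.
apply: le_lt_trans (energyD P (cmeasurableB mf mg) (cmeasurableB mg mh)) _.
have -> : e%:E = (2%:E * (e / 4 + e / 4)%:E)%E by rewrite -EFinM; congr EFin; field.
by rewrite lte_pmul2l // EFinD lteD.
Qed.

Lemma approximable_ae f g : cmeasurable f -> approximable g ->
  (\forall w \ae P, f w = g w) -> approximable f.
Proof.
move=> mf ag fg; apply: approximable_limit => // e e0; exists g => //.
rewrite (@energy_ae _ _ _ P _ (fun=> 0)).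
- by rewrite /energy; under eq_integral do rewrite sqn0; rewrite integral0 lte_fin.
- exact: cmeasurableB mf ag.1.
- exact: cmeasurable_cst.
- by apply: filterS fg => w ->; rewrite subrr.
Qed.

Lemma approximable_in f : A f -> approximable f.
Proof.
move=> Af; split=> [|e e0]; first exact: mA.
exists f; last first.
  rewrite /energy; under eq_integral do rewrite subrr sqn0.
  by rewrite integral0 lte_fin.
exists 1%N, (fun=> 1), (fun=> f); split=> //.
by apply/funext => w; rewrite big_ord1 mul1r.
Qed.

Lemma approximable_lin (a : C) f g : approximable f -> approximable g ->
  approximable (fun w => a * f w + g w).
Proof.
move=> [mf fapp] [mg gapp]; split.
  by apply: cmeasurableD => //; apply: cmeasurableM => //; exact: cmeasurable_cst.
move=> e e0; pose e' := e / (4 * (sqn a + 1)).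
have a1 : 0 < sqn a + 1 by rewrite ltr_wpDl ?sqn_ge0.
have e'0 : 0 < e' by rewrite divr_gt0 // mulr_gt0.
have e40 : 0 < e / 4 by rewrite divr_gt0.
have [h hs fh] := fapp _ e'0; have [k ks gk] := gapp _ e40.
exists (fun w => a * h w + k w); first exact: in_span_lin.
have [mh mk] := (in_span_cmeasurable hs, in_span_cmeasurable ks).
have -> : (fun w => a * f w + g w - (a * h w + k w)) =
    (fun w => a * (f w - h w) + (g w - k w)).
  by apply/funext => w; ring.
have mfh := cmeasurableB mf mh.
have mafh : cmeasurable (fun w => a * (f w - h w)).
  by apply: cmeasurableM => //; exact: cmeasurable_cst.
apply: le_lt_trans (energyD P mafh (cmeasurableB mg mk)) _.
rewrite energyZ //.
have -> : e%:E = (2%:E * (e / 4 + e / 4)%:E)%E by rewrite -EFinM; congr EFin; field.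
rewrite lte_pmul2l // [X in (_ < X)%E]EFinD lee_ltD //.
  by rewrite fin_numM // ge0_fin_numE ?energy_ge0 // (lt_trans fh) // ltry.
apply: (@le_trans _ _ ((sqn a)%:E * e'%:E)%E).
  by rewrite lee_wpmul2l ?lee_fin ?sqn_ge0 // ltW.
rewrite -EFinM lee_fin /e'.
have -> : e / (4 * (sqn a + 1)) = (e / 4) / (sqn a + 1) by field; rewrite gt_eqF.
by rewrite mulrA ler_pdivrMr // mulrC ler_pM2l // lerDl.
Qed.

End ClosedSpan.

Section RealApproximation.
Import HBNNSimple.
Context (R : realType) d (Omega : measurableType d) (P : probability Omega R).
Local Notation C := R[i].
Context (A : set (Omega -> C)).
Hypothesis mA : forall p, A p -> cmeasurable p.
Local Notation rapprox f := (approximable P A (fun w => (f w)%:C%C)).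

Lemma cmeasurable_real (f : Omega -> R) :
  measurable_fun setT f -> cmeasurable (fun w => (f w)%:C%C).
Proof. by move=> mf; split => /=. Qed.

(** Bounded pointwise limits are L2 limits for a probability measure. *)
Lemma approximable_bclosure (K : set (Omega -> R)) :
  (forall f, K f -> rapprox f) -> forall f, bclosure K f -> rapprox f.
Proof.
move=> KA f; elim=> [{}f /KA //|a {}f g _ fapp _ gapp|F M {}f _ Fapp FM Ff].
  have H := approximable_lin mA (a%:C)%C fapp gapp.
  by congr (approximable P A _): H; apply/funext => w; rewrite rmorphD rmorphM.
have mF n : measurable_fun setT (F n) by exact: (Fapp n).1.1.
have mf : measurable_fun setT f by apply: measurable_fun_cvg mF _ => w _; exact: Ff.
have fM w : `|f w| <= M.
  have cF : `|F n w| @[n --> \oo] --> `|f w| by apply: cvg_norm.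
  have -> : `|f w| = limn (fun n => `|F n w|) by apply/esym/cvg_lim.
  by apply: limr_le; [exact: cvgP cF|near=> n].
apply: approximable_limit => //.
move=> e e0; have [||n Hn] := @energy_dominated _ _ _ P f (fun=> (2 * M) ^+ 2) F
   mf mF (measurable_cst _) _ _ Ff e e0.
- move=> n w; rewrite -(real_normK (num_real (_ - _))).
  rewrite ler_sqr ?nnegrE ?normr_ge0 //; last first.
    by rewrite mulr_ge0 // (le_trans _ (fM w)).
  by have := ler_normB (f w) (F n w); have := fM w; have := FM n w; lra.
- by rewrite integral_cst //= probability_setT mule1 ltry.
- by exists (fun w => (F n w)%:C%C).
Unshelve. all: by end_near. Qed.

(** A nonnegative function is the limit of simple functions below it, with
    squared errors below its square; in general, split [f] into its positive and
    negative parts. *)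
Lemma approximable_square_integrable (G : set (set Omega)) (f : Omega -> R) :
  (forall D, <<s G >> D -> rapprox (\1_D : Omega -> R)) ->
  (forall D, <<s G >> D -> measurable D) ->
  measurable_fun setT (f : g_sigma_algebraType G -> R) ->
  (\int[P]_w ((f w) ^+ 2)%:E < +oo)%E -> rapprox f.
Proof.
move=> GA Gm; pose T' := g_sigma_algebraType G.
pose K : set (Omega -> R) := [set h | exists2 D, <<s G >> D & h = \1_D].
have KA : forall h, K h -> rapprox h by move=> _ [D mD ->]; exact: GA.
have mG (h : Omega -> R) : measurable_fun setT (h : T' -> R) -> measurable_fun setT h.
  by move=> mh _ D mD; apply: Gm; exact: mh.
have pos (h : Omega -> R) : (forall w, 0 <= h w) -> measurable_fun setT (h : T' -> R) ->
    (\int[P]_w ((h w) ^+ 2)%:E < +oo)%E -> rapprox h.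
  move=> h0 mh hfin.
  have meh : measurable_fun setT (fun w : T' => (h w)%:E).
    exact/(@measurable_EFinP _ T').
  have [g [ndg gh]] := approximation (@measurableT _ T') meh (fun w _ => h0 w).
  have gcvg w : g n w @[n --> \oo] --> h w.
    by have /fine_cvgP[_] := gh w I.
  have gle n w : g n w <= h w.
    rewrite -(cvg_lim _ (gcvg w)) //; apply: nondecreasing_cvgn_le.
      by move=> i j ij; have /lefP := ndg _ _ ij; apply.
    exact: cvgP (gcvg w).
  have mg n : measurable_fun setT (g n : T' -> R) by [].
  apply: approximable_limit => //; first by apply: cmeasurable_real; exact: mG.
  move=> e e0; have [||n Hn] := @energy_dominated _ _ _ P h (fun w => h w ^+ 2)
     (fun n => g n : Omega -> R) (mG _ mh) (fun n => mG _ (mg n)) _ _ hfin gcvg e e0.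
  - by apply: measurable_funX; exact: mG.
  - move=> n w; rewrite ler_sqr ?nnegrE ?subr_ge0 // gerBl; exact: fun_ge0.
  - exists (fun w => (g n w)%:C%C) => //; apply: (approximable_bclosure KA).
    have [m [s gE]] : exists m (s : nat -> R),
        forall w, g n w = \sum_(i < m) (s i * \1_(g n @^-1` [set s i]) w).
      eexists; exists (nth 0 (finmap.enum_fset (fset_set (g n @` setT)))) => w.
      exact: fimfunEord.
    apply: bclosure_ext (_ : bclosure K
        (fun w => \sum_(i < m) (s i * \1_(g n @^-1` [set s i]) w))) _ => [|w]; last by rewrite gE.
    elim: m {gE} => [|m IH].
      apply: bclosure_in; exists set0; first exact: (@measurable0 _ T').
      by apply/funext => w; rewrite big_ord0 indic0.
    have kI : bclosure K (\1_(g n @^-1` [set s m])).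
      apply: bclosure_in; exists (g n @^-1` [set s m]) => //.
      have := mg n (@measurableT _ T') _ (measurable_set1 (s m)).
      by rewrite setTI.
    apply: bclosure_ext (bclosure_lin (s m) kI IH) _ => w.
    by rewrite big_ord_recr /= addrC.
move=> mf ffin.
have mnf : measurable_fun setT (fun w : T' => `|f w|) by exact: measurableT_comp.
have sqle (h : Omega -> R) : measurable_fun setT (h : T' -> R) ->
    (forall w, `|h w| <= `|f w|) -> (\int[P]_w ((h w) ^+ 2)%:E < +oo)%E.
  move=> mh hf; apply: le_lt_trans ffin; apply: ge0_le_integral => //.
  - by move=> w _; rewrite lee_fin sqr_ge0.
  - by apply/measurable_EFinP; apply: measurable_funX; exact: mG.
  - by apply/measurable_EFinP; apply: measurable_funX; exact: mG.
  - move=> w _; rewrite lee_fin -(real_normK (num_real (h w))) -(real_normK (num_real (f w))).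
    by rewrite ler_sqr ?nnegrE.
(* [s = 1] gives the positive part and [s = -1] the negative one. *)
have part (s : R) : `|s| = 1 -> rapprox (fun w => 2^-1 * (`|f w| + s * f w)).
  move=> s1.
  have nsf w : `|s * f w| = `|f w| by rewrite normrM s1 mul1r.
  have p0 w : 0 <= 2^-1 * (`|f w| + s * f w).
    by rewrite mulr_ge0 ?invr_ge0 // -(nsf w) addrC -lerBlDr sub0r lerNl ler_normr lexx orbT.
  have mp : measurable_fun setT ((fun w => 2^-1 * (`|f w| + s * f w)) : T' -> R).
    apply: measurable_funM => //; apply: measurable_funD => //.
    exact: measurable_funM.
  apply: pos => //; apply: sqle => // w; rewrite ger0_norm //.
  have := ler_norm (s * f w); rewrite nsf; lra.
have H := approximable_lin mA (-1) (part (-1) (normrN1 _)) (part 1 (normr1 _)).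
congr (approximable P A _): H; apply/funext => w.
by rewrite mulN1r -rmorphN -rmorphD; congr (_%:C)%C; field.
Qed.

End RealApproximation.

Section Density.
Context (R : realType) (B : completeNormedModType R) (sepB : separable_space B).
Context d (Omega : measurableType d) (P : probability Omega R).
Context (L : R -> Omega -> B) (levyL : levy_process P L).
Local Notation C := R[i].
Context (t : R) (t0 : 0 < t).
Local Notation products := (unit_product P L t).

(** Finite sums of functionals of the process, built term by term because each
    term refines a step path. *)
Inductive observable : (Omega -> R) -> Prop :=
| observable0 : observable (fun=> 0)
| observableS r phi f : 0 <= r <= t -> dual phi -> observable f ->
    observable (fun w => phi (increment L 0 r w) + f w).

Lemma observableD f g : observable f -> observable g -> observable (fun w => f w + g w).
Proof.
move=> + og; elim=> [|r phi {}f rt dphi _ IH].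
  by under eq_fun do rewrite add0r.
by under eq_fun do rewrite -addrA; exact: observableS.
Qed.

Lemma observableZ (a : R) f : observable f -> observable (fun w => a * f w).
Proof.
elim=> [|r phi {}f rt dphi _ IH].
  by under eq_fun do rewrite mulr0; exact: observable0.
by under eq_fun do rewrite mulrDr; exact: (observableS rt (dualZ a dphi) IH).
Qed.

Lemma observable_phase f : observable f -> exists l, [/\ admissible l, total l = t &
  forall w, phase L l 0 w = f w].
Proof.
elim=> [|r phi {}f /andP[r0 rt] dphi _ [l [al lt lf]]].
  exists [:: (t, cst 0)]; split=> [|/=|w] /=; rewrite ?addr0 //; split=> //.
  by split=> [a x y|x]; [rewrite scaler0 addr0|exact: cvg_cst].
have [r0'|] := ltP 0 r; last first.
  move=> r0'; have -> : r = 0 by apply/eqP; rewrite eq_le r0' r0.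
  exists l; split=> // w; rewrite lf /increment subrr.
  by have := dualB 0 0 dphi; rewrite !subrr => ->; rewrite add0r.
have [|l' [al' lt' lf']] := phase_add L 0 al dphi r0'; first by rewrite lt.
by exists l'; split=> // [|w]; [rewrite lt'|rewrite lf' lf add0r].
Qed.

Lemma products_cmeasurable p : products p -> cmeasurable p.
Proof.
move=> /(unit_product_fiber sepB levyL)[_ [mp _]].
by apply: cmeasurable_sub mp; exact: past_measurable.
Qed.

Lemma approximable_observable f : observable f -> approximable P products (fun w => cis (f w)).
Proof.
move=> /observable_phase[l [al lt lf]].
have [|p pp pE] := phase_unit_product sepB levyL al; first by rewrite lt.
rewrite lt in pp; have [mf _] := fiber_phase sepB P L al lt.
have -> : (fun w => cis (f w)) = (fun w => cis (phase L l 0 w)).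
  by apply/funext => w; rewrite lf.
apply: (approximable_ae products_cmeasurable _ (approximable_in P products_cmeasurable pp)).
  by apply: cmeasurable_sub mf; exact: past_measurable.
by apply: filterS pE => w ->.
Qed.

(** Cosine and sine are combinations of a character and of its conjugate, the
    character of the opposite observable. *)
Lemma approximable_characters f : characters observable f ->
  approximable P products (fun w => (f w)%:C%C).
Proof.
move=> [th oth fE]; have a1 := approximable_observable oth.
have := approximable_observable (observableZ (-1) oth).
have -> : (fun w => cis (-1 * th w)) = (fun w => (cos (th w) +i* - sin (th w))%C).
  by apply/funext => w; rewrite mulN1r /cis cosN sinN.
(* The last function of [approximable_lin] has coefficient [1]; writing the
   coefficient [c] as [(c - 1) + 1] makes up for it. *)
move=> a2.
case: fE => ->.
- have H := approximable_lin products_cmeasurable (2^-1)%:C%C a1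
    (approximable_lin products_cmeasurable ((2^-1)%:C%C - 1) a2 a2).
  congr (approximable P products _): H; apply/funext => w.
  by apply: complex_ext; rewrite ?(ReD, ImD, ReM, ImM, ReN, ImN) /=; field.
- have H := approximable_lin products_cmeasurable (0 +i* (- 2^-1))%C a1
    (approximable_lin products_cmeasurable ((0 +i* 2^-1)%C - 1) a2 a2).
  congr (approximable P products _): H; apply/funext => w.
  by apply: complex_ext; rewrite ?(ReD, ImD, ReM, ImM, ReN, ImN) /=; field.
Qed.

Definition observable_events : set (set Omega) :=
  [set D | exists th a, observable th /\ D = [set w | a < th w]].

(** In a separable space the continuous functionals generate the Borel events of
    each increment. *)
Lemma past_observable_events D : <<s past P L t >> D ->
  exists2 D', <<s observable_events >> D' & \forall w \ae P, D w <-> D' w.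
Proof.
move=> sD.
apply: (@sigma_algebra_ae_preimage _ _ _ P _ (g_sigma_algebraType observable_events)
  (fun w => w) (past P L t)) sD => {}D [[r /= rt [E mE <-]]|/null_set_ae nD]; last first.
  by exists set0 => //; apply: filterS nD => w; split.
have mr : measurable_fun setT
    (increment L 0 r : g_sigma_algebraType observable_events -> borel B).
  apply: measurable_fun_dual => // phi dphi.
  apply: (measurability _ (RGenOInfty.measurableE R)) => _ [_ [a ->] <-].
  rewrite setTI; apply: sub_sigma_algebra.
  exists (fun w => phi (increment L 0 r w) + 0), a; split.
    by apply: observableS => //; exact: observable0.
  by apply/seteqP; split=> w /=; rewrite in_itv /= andbT addr0.
exists (increment L 0 r @^-1` E).
  by have := mr (@measurableT _ (g_sigma_algebraType observable_events)) E mE; rewrite setTI.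
have := levy_start levyL; apply: filterS => w L0.
by rewrite setTI /= /increment L0 subr0.
Qed.

(** Indicators of events of the past are bounded limits of trigonometric
    functions of observables. *)
Lemma approximable_past_event D : <<s past P L t >> D ->
  approximable P products (fun w => (\1_D w : R)%:C%C).
Proof.
move=> sD; have [D' sD' DD'] := past_observable_events sD.
have H := bclosure_characters_sigma observable0 observableD observableZ sD'.
have aD' := approximable_bclosure products_cmeasurable approximable_characters H.
apply: (approximable_ae products_cmeasurable _ aD').
  apply: cmeasurable_real; apply: measurable_indic; exact: (past_measurable levyL sD).
apply: filterS DD' => w DD'; rewrite !indicE; congr (_%:R%:C)%C; congr nat_of_bool.
by apply/idP/idP => /set_mem /DD' /mem_set.
Qed.

Lemma fiber_closed_span : fiber P L t `<=` closed_span P products.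
Proof.
move=> f [mf ffin]; have mf' : cmeasurable f.
  by apply: cmeasurable_sub mf; exact: past_measurable.
have part (p : C -> R) : measurable_fun setT ((fun w => p (f w)) :
      g_sigma_algebraType (past P L t) -> R) ->
    (forall z, p z ^+ 2 <= sqn z) -> approximable P products (fun w => (p (f w))%:C%C).
  move=> mp psqn; apply: (approximable_square_integrable products_cmeasurable
    approximable_past_event (past_measurable levyL (t := t)) mp).
  rewrite L2norm_lty in ffin; apply: le_lt_trans ffin.
  have mpO : measurable_fun setT (fun w => p (f w)).
    by move=> _ D mD; apply: (past_measurable levyL); exact: mp.
  apply: ge0_le_integral => //.
  - by move=> w _; rewrite lee_fin sqr_ge0.
  - by apply/measurable_EFinP; apply: measurable_funX.
  - exact: measurable_esqn.
  - by move=> w _; rewrite lee_fin.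
have aR : approximable P products (fun w => (complex.Re (f w))%:C%C).
  by apply: (part (@complex.Re R) mf.1) => z; rewrite lerDl sqr_ge0.
have aI : approximable P products (fun w => (complex.Im (f w))%:C%C).
  by apply: (part (@complex.Im R) mf.2) => z; rewrite lerDr sqr_ge0.
have [_ fapp] : approximable P products f.
  have H := approximable_lin products_cmeasurable 'i%C aI aR.
  by congr (approximable P products _): H; apply/funext => w; rewrite [RHS]complexE addrC.
split.
  split=> //; split=> _ D mD; apply: sub_sigma_algebra; [exact: mf'.1|exact: mf'.2].
move=> e e0; have e20 : 0 < e ^+ 2 by rewrite exprn_gt0.
have [_ [n [c [p [pp ->]]]] fh] := fapp _ e20.
by exists n, c, p; split=> //; rewrite L2norm_lt.
Qed.

End Density.

Theorem theorem4p5 (R : realType) (B : completeNormedModType R)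
    (d : measure_display) (Omega : measurableType d) (P : probability Omega R)
    (L : R -> Omega -> B) (b : B) (Q : (B -> R^o) -> (B -> R^o) -> R)
    (sepB : separable_space B)
    (levyL : levy_process P L)
    (sigmaL : (@measurable d Omega : set (set Omega)) = process_sigma_algebra L)
    (covQ : covariance_form Q)
    (nondegQ : nondegenerate_covariance Q)
    (gaussL : gaussian_without_jumps P L b Q)
    (suppL : fully_supported P L) :
  completely_spatial P L.
Proof.
split.
  exists (character_unit L (cst 0)); apply: character_unit_is_unit => //.
  by split=> [a x y|x]; [rewrite scaler0 addr0|exact: cvg_cst].
move=> t t0; apply/seteqP; split; first exact: fiber_closed_span.
exact: closed_span_fiber.
Qed.
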